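(* Let $L\subseteq[0,\infty)^r$ be an additive semigroup with $0\in L$ and $w$ an admissible weight function on $L$. If $a\in\mathscr A_w(L)$ satisfies $0\notin\overline{\widetilde a(\mathbb H^r)}$, then $a$ is invertible in $\mathscr A_w(L)$.
   Context: $\mathbb H=\{\operatorname{Re}s>0\}$. A weight function is $w\colon L\to(0,\infty)$ with $w(0)=1$, $w(\lambda+\lambda')\le w(\lambda)w(\lambda')$; admissible: $w\ge1$ and $\lim_{k\to\infty}w(k\lambda)^{1/k}=1$ for all $\lambda\in L$. $\mathscr A_w(L)$: functions $a\colon L\to\mathbb C$ with $\sum_{\lambda\in L}|a(\lambda)|w(\lambda)<\infty$ and convolution $(a*b)(\lambda)=\sum_{\lambda'+\lambda''=\lambda}a(\lambda')b(\lambda'')$. For $\lambda=(\lambda_1,\dots,\lambda_r)$ and $s=(s_1,\dots,s_r)$ put $\lambda\cdot s=\sum\lambda_\varrho s_\varrho$ and $\widetilde a(s)=\sum_{\lambda\in L}a(\lambda)e^{-\lambda\cdot s}$ for $s\in\overline{\mathbb H}^r$. *)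

(* Defs.v *)
From Stdlib Require Import Reals List ClassicalEpsilon.
Import ListNotations.
Open Scope R_scope.

Definition Cx := (R * R)%type.
Definition C0 : Cx := (0, 0).
Definition C1 : Cx := (1, 0).
Definition Cadd (z w : Cx) : Cx := (fst z + fst w, snd z + snd w).
Definition Cmul (z w : Cx) : Cx :=
  (fst z * fst w - snd z * snd w, fst z * snd w + snd z * fst w).
Definition Copp (z : Cx) : Cx := (- fst z, - snd z).
Definition Cnorm (z : Cx) : R := sqrt (fst z ^ 2 + snd z ^ 2).
Definition RtoC (x : R) : Cx := (x, 0).
Definition Cexp (z : Cx) : Cx := (exp (fst z) * cos (snd z), exp (fst z) * sin (snd z)).

Definition Csum_list {I : Type} (f : I -> Cx) (l : list I) : Cx :=
  fold_right (fun i acc => Cadd (f i) acc) C0 l.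
Definition Rsum_list {I : Type} (f : I -> R) (l : list I) : R :=
  fold_right (fun i acc => f i + acc) 0 l.

(** Unordered (net-of-finite-subsets) sum over an arbitrary index type. *)
Definition has_sum {I : Type} (f : I -> Cx) (z : Cx) : Prop :=
  forall eps, 0 < eps ->
    exists l0 : list I, NoDup l0 /\
      forall l : list I, NoDup l -> incl l0 l ->
        Cnorm (Cadd (Csum_list f l) (Copp z)) < eps.

(** Summability of a nonnegative family: finite partial sums are bounded. *)
Definition R_summable {I : Type} (f : I -> R) : Prop :=
  exists M, forall l : list I, NoDup l -> Rsum_list f l <= M.

(** Vectors in R^r are modelled as functions nat -> R vanishing at indices >= r. *)
Definition vzero : nat -> R := fun _ => 0.
Definition vadd (x y : nat -> R) : nat -> R := fun i => x i + y i.
Definition vscal (k : R) (x : nat -> R) : nat -> R := fun i => k * x i.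

Definition is_semigroup_in (r : nat) (L : (nat -> R) -> Prop) : Prop :=
  L vzero /\
  (forall x y, L x -> L y -> L (vadd x y)) /\
  (forall x, L x -> (forall i, (i < r)%nat -> 0 <= x i) /\
                    (forall i, (r <= i)%nat -> x i = 0)).

Definition is_weight (L : (nat -> R) -> Prop) (w : (nat -> R) -> R) : Prop :=
  (forall x, L x -> 0 < w x) /\ w vzero = 1 /\
  (forall x y, L x -> L y -> w (vadd x y) <= w x * w y).

Definition admissible (L : (nat -> R) -> Prop) (w : (nat -> R) -> R) : Prop :=
  is_weight L w /\
  (forall x, L x -> 1 <= w x) /\
  (forall x, L x ->
     Un_cv (fun k : nat => Rpower (w (vscal (INR k) x)) (/ INR k)) 1).

Definition Lelt (L : (nat -> R) -> Prop) := { x : nat -> R | L x }.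

Definition in_Aw (L : (nat -> R) -> Prop) (w : (nat -> R) -> R)
    (a : (nat -> R) -> Cx) : Prop :=
  R_summable (fun x : Lelt L => Cnorm (a (proj1_sig x)) * w (proj1_sig x)).

Definition Lpairs (L : (nat -> R) -> Prop) (x : nat -> R) :=
  { p : (nat -> R) * (nat -> R) | L (fst p) /\ L (snd p) /\ vadd (fst p) (snd p) = x }.

(** a is invertible in A_w(L): there is b in A_w(L) with a * b = 1,
    the unit being the delta function at 0. *)
Definition invertible_Aw (L : (nat -> R) -> Prop) (w : (nat -> R) -> R)
    (a : (nat -> R) -> Cx) : Prop :=
  exists b : (nat -> R) -> Cx, in_Aw L w b /\
    forall x, L x ->
      has_sum (fun p : Lpairs L x =>
                 Cmul (a (fst (proj1_sig p))) (b (snd (proj1_sig p))))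
              (match excluded_middle_informative (x = vzero) with
               | left _ => C1 | right _ => C0 end).

Definition in_Hr (r : nat) (s : nat -> Cx) : Prop :=
  forall i, (i < r)%nat -> 0 < fst (s i).

Fixpoint dotC (r : nat) (x : nat -> R) (s : nat -> Cx) : Cx :=
  match r with
  | O => C0
  | S r' => Cadd (dotC r' x s) (Cmul (RtoC (x r')) (s r'))
  end.

Definition gelfand_value (r : nat) (L : (nat -> R) -> Prop)
    (a : (nat -> R) -> Cx) (s : nat -> Cx) (z : Cx) : Prop :=
  has_sum (fun x : Lelt L =>
             Cmul (a (proj1_sig x)) (Cexp (Copp (dotC r (proj1_sig x) s)))) z.

Definition in_closure_image (r : nat) (L : (nat -> R) -> Prop)
    (a : (nat -> R) -> Cx) (z : Cx) : Prop :=
  forall eps, 0 < eps ->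
    exists s u, in_Hr r s /\ gelfand_value r L a s u /\
                Cnorm (Cadd u (Copp z)) < eps.

(* Main.v *)
(** A Newman-style argument that avoids Gelfand theory. Put [vsum x = x_1 + ... + x_r] and let
    [tw tau p] be the finite sum [p] with coefficients multiplied by [exp (- tau * vsum x)], so
    that the values of [p] on the line [Re s_1 = ... = Re s_r = tau] are those of [tw tau p] on
    the imaginary line.

    Replace [a] by a finite partial sum [p] that is bounded below by [d] on [H^r]; its support
    generates a finitely generated monoid [M]. For large [tau], [tw tau p] is a small perturbation
    of its nonzero constant term, hence invertible. Suppose that [tw tau p] is invertible. The
    coefficients of its [- N]-th power are at most [d ^ - N], because a coefficient is a mean of
    values. Since [M] is finitely generated, an arbitrarily small damping [h > 0] turns this into
    an [l^1] bound [K d ^ - N], and with [N] large this makes every perturbation of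
    [tw (tau + h) p] of norm less than [d] invertible, in particular [tw (tau - h) p]. The
    admissible step [h] does not depend on [tau], so the descent passes beyond [tau = 0]. The
    margin gained there dominates the subexponential weight, so [p ^ - N] is [O (d ^ - N)] also
    in the norm with weight [w], and the same perturbation argument inverts [a].

    All of this is done with finite sums and approximate inverses; only the last step takes
    a limit. *)
From Stdlib Require Import Reals List ClassicalEpsilon FunctionalExtensionality
  Permutation Lra Lia Setoid Morphisms.
From Coquelicot Require Complex.
Require Import Defs.
Import ListNotations.
Open Scope R_scope.

(** * Complex numbers and finite sums *)

Notation Csub z u := (Cadd z (Copp u)).

Lemma Cx_ring : ring_theory C0 C1 Cadd Cmul (fun z u => Csub z u) Copp (@eq Cx).
Proof.
  constructor; intros; unfold C0, C1, Cadd, Cmul, Copp in *;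
    repeat match goal with z : Cx |- _ => destruct z end; simpl;
    try reflexivity; f_equal; ring.
Qed.
Add Ring Cx_ring : Cx_ring.

Lemma Cnorm_ge0 z : 0 <= Cnorm z.
Proof. apply sqrt_pos. Qed.

Lemma Cnorm_add z u : Cnorm (Cadd z u) <= Cnorm z + Cnorm u.
Proof. exact (Complex.Cmod_triangle z u). Qed.

Lemma Cnorm_mul z u : Cnorm (Cmul z u) = Cnorm z * Cnorm u.
Proof. exact (Complex.Cmod_mult z u). Qed.

Lemma Cnorm_opp z : Cnorm (Copp z) = Cnorm z.
Proof. exact (Complex.Cmod_opp z). Qed.

Lemma Cnorm_RtoC x : Cnorm (RtoC x) = Rabs x.
Proof. exact (Complex.Cmod_R x). Qed.

Lemma Cnorm_C0 : Cnorm C0 = 0.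
Proof. exact Complex.Cmod_0. Qed.

Lemma Cnorm_C1 : Cnorm C1 = 1.
Proof. exact Complex.Cmod_1. Qed.

Lemma Cnorm_eq0 z : Cnorm z = 0 -> z = C0.
Proof. exact (Complex.Cmod_eq_0 z). Qed.

Lemma Cnorm_sub z u : Cnorm (Csub z u) <= Cnorm z + Cnorm u.
Proof. rewrite <- (Cnorm_opp u). apply Cnorm_add. Qed.

Lemma Cnorm_sub_sym z u : Cnorm (Csub z u) = Cnorm (Csub u z).
Proof. rewrite <- Cnorm_opp. f_equal. ring. Qed.

Lemma Cnorm_sub_ge z u : Cnorm z - Cnorm u <= Cnorm (Csub z u).
Proof.
  replace z with (Cadd (Csub z u) u) at 1 by ring.
  pose proof (Cnorm_add (Csub z u) u). lra.
Qed.

Lemma Rabs_fst_le z : Rabs (fst z) <= Cnorm z.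
Proof.
  unfold Cnorm. rewrite <- sqrt_Rsqr_abs. apply sqrt_le_1_alt.
  unfold Rsqr. pose proof (pow2_ge_0 (snd z)). lra.
Qed.

Lemma Rabs_snd_le z : Rabs (snd z) <= Cnorm z.
Proof.
  unfold Cnorm. rewrite <- sqrt_Rsqr_abs. apply sqrt_le_1_alt.
  unfold Rsqr. pose proof (pow2_ge_0 (fst z)). lra.
Qed.

Lemma Cnorm_le_Rabs z : Cnorm z <= Rabs (fst z) + Rabs (snd z).
Proof.
  pose proof (Rabs_pos (fst z)). pose proof (Rabs_pos (snd z)).
  unfold Cnorm. rewrite <- (sqrt_pow2 (Rabs (fst z) + Rabs (snd z))) by lra.
  apply sqrt_le_1_alt. rewrite <- (pow2_abs (fst z)), <- (pow2_abs (snd z)). nra.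
Qed.

Definition Cinv (z : Cx) : Cx := Complex.Cinv z.

Lemma Cmul_inv_l z : z <> C0 -> Cmul (Cinv z) z = C1.
Proof. exact (Complex.Cinv_l z). Qed.

Definition cis (x : R) : Cx := (cos x, sin x).

Lemma cis_add x y : cis (x + y) = Cmul (cis x) (cis y).
Proof. unfold cis, Cmul; simpl. rewrite cos_plus, sin_plus. f_equal; ring. Qed.

Lemma cis_0 : cis 0 = C1.
Proof. unfold cis. rewrite cos_0, sin_0. reflexivity. Qed.

Lemma Cnorm_cis x : Cnorm (cis x) = 1.
Proof.
  unfold Cnorm, cis. transitivity (sqrt 1); [f_equal|apply sqrt_1].
  pose proof (sin2_cos2 x). unfold Rsqr in *. simpl. lra.
Qed.

Lemma Cexp_cis z : Cexp z = Cmul (RtoC (exp (fst z))) (cis (snd z)).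
Proof. unfold Cexp, Cmul, RtoC, cis; simpl. f_equal; ring. Qed.

Lemma RtoC_mul x y : RtoC (x * y) = Cmul (RtoC x) (RtoC y).
Proof. unfold RtoC, Cmul; simpl. f_equal; ring. Qed.

Lemma RtoC_1 : RtoC 1 = C1.
Proof. reflexivity. Qed.

(** The conjugate phase of [z], that is [|z| / z], with default [C0] at zero: multiplying by it
    turns a coefficient into its modulus. *)
Definition Csign (z : Cx) : Cx :=
  if excluded_middle_informative (z = C0) then C0
  else Cmul (RtoC (Cnorm z)) (Cinv z).

Lemma Cmul_Csign z : Cmul z (Csign z) = RtoC (Cnorm z).
Proof.
  unfold Csign. destruct (excluded_middle_informative _) as [->|Hz].
  - rewrite Cnorm_C0. change (RtoC 0) with C0. ring.
  - transitivity (Cmul (RtoC (Cnorm z)) (Cmul (Cinv z) z)); [ring|].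
    rewrite Cmul_inv_l by assumption. ring.
Qed.

Lemma Cnorm_Csign z : Cnorm (Csign z) <= 1.
Proof.
  destruct (excluded_middle_informative (z = C0)) as [E|E].
  - unfold Csign. destruct (excluded_middle_informative _); [|contradiction].
    rewrite Cnorm_C0. lra.
  - assert (0 < Cnorm z).
    { destruct (Cnorm_ge0 z) as [|H]; auto. symmetry in H.
      apply Cnorm_eq0 in H. contradiction. }
    apply Req_le, (Rmult_eq_reg_l (Cnorm z)); [|lra].
    rewrite <- Cnorm_mul, Cmul_Csign, Cnorm_RtoC, Rabs_pos_eq by lra. ring.
Qed.

Definition Ccv (u : nat -> Cx) (z : Cx) : Prop :=
  forall eps, 0 < eps ->
    exists N, forall n, (N <= n)%nat -> Cnorm (Csub (u n) z) <= eps.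

Lemma C_complete (u : nat -> Cx) :
  (forall eps, 0 < eps -> exists N, forall n m,
      (N <= n)%nat -> (N <= m)%nat -> Cnorm (Csub (u n) (u m)) <= eps) ->
  exists z, Ccv u z.
Proof.
  intros Hc.
  assert (H1 : Cauchy_crit (fun n => fst (u n))).
  { intros e He. destruct (Hc (e / 2)) as [N HN]; [lra|]. exists N. intros n m Hn Hm.
    pose proof (Rabs_fst_le (Csub (u n) (u m))). specialize (HN n m Hn Hm).
    unfold Rdist. simpl in H. unfold Rminus. lra. }
  assert (H2 : Cauchy_crit (fun n => snd (u n))).
  { intros e He. destruct (Hc (e / 2)) as [N HN]; [lra|]. exists N. intros n m Hn Hm.
    pose proof (Rabs_snd_le (Csub (u n) (u m))). specialize (HN n m Hn Hm).
    unfold Rdist. simpl in H. unfold Rminus. lra. }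
  destruct (R_complete _ H1) as [x Hx]. destruct (R_complete _ H2) as [y Hy].
  exists (x, y). intros e He.
  destruct (Hx (e / 2)) as [N1 HN1]; [lra|]. destruct (Hy (e / 2)) as [N2 HN2]; [lra|].
  exists (Nat.max N1 N2). intros n Hn.
  eapply Rle_trans; [apply Cnorm_le_Rabs|]. simpl.
  specialize (HN1 n ltac:(lia)). specialize (HN2 n ltac:(lia)).
  unfold Rdist, Rminus in *. lra.
Qed.

Lemma Cnorm_limit_le (u : nat -> Cx) z (c : R) n0 :
  Ccv u z -> (forall n, (n0 <= n)%nat -> Cnorm (u n) <= c) -> Cnorm z <= c.
Proof.
  intros Hu Hc. apply Rnot_lt_le. intros Hlt.
  destruct (Hu ((Cnorm z - c) / 2)) as [N HN]; [lra|].
  specialize (HN (Nat.max N n0) ltac:(lia)). specialize (Hc (Nat.max N n0) ltac:(lia)).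
  rewrite Cnorm_sub_sym in HN. pose proof (Cnorm_sub_ge z (u (Nat.max N n0))). lra.
Qed.

(** A classical truth value, so that [filter] can select by arbitrary propositions such as
    membership in [L]. *)
Definition asb (P : Prop) : bool := if excluded_middle_informative P then true else false.

Lemma asbP P : asb P = true <-> P.
Proof.
  unfold asb. destruct (excluded_middle_informative P); split; intros; auto; discriminate.
Qed.

Lemma asb_true (P : Prop) : P -> asb P = true.
Proof. apply asbP. Qed.

Lemma asb_false (P : Prop) : ~ P -> asb P = false.
Proof.
  intros H. unfold asb. destruct (excluded_middle_informative P); [contradiction|reflexivity].
Qed.

Section Sums.
Context {I : Type}.
Implicit Types (f g : I -> Cx) (h k : I -> R) (l : list I).

Definition eqdec_classic (x y : I) : {x = y} + {x <> y} :=
  excluded_middle_informative (x = y).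

Lemma Csum_ext f g l : (forall i, In i l -> f i = g i) -> Csum_list f l = Csum_list g l.
Proof.
  induction l as [|i l IH]; simpl; intros H; [reflexivity|].
  rewrite H, IH by auto. reflexivity.
Qed.

Lemma Csum_app f l l' : Csum_list f (l ++ l') = Cadd (Csum_list f l) (Csum_list f l').
Proof. induction l as [|i l IH]; simpl; [ring|]. rewrite IH. ring. Qed.

Lemma Csum_add f g l :
  Csum_list (fun i => Cadd (f i) (g i)) l = Cadd (Csum_list f l) (Csum_list g l).
Proof. induction l as [|i l IH]; simpl; [ring|]. rewrite IH. ring. Qed.

Lemma Csum_scal c f l : Csum_list (fun i => Cmul c (f i)) l = Cmul c (Csum_list f l).
Proof. induction l as [|i l IH]; simpl; [ring|]. rewrite IH. ring. Qed.

Lemma Csum_zero l : Csum_list (fun _ : I => C0) l = C0.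
Proof. induction l as [|i l IH]; simpl; [reflexivity|]. rewrite IH. ring. Qed.

Lemma Csum_perm f l l' : Permutation l l' -> Csum_list f l = Csum_list f l'.
Proof. induction 1; simpl; try congruence. ring. Qed.

Lemma Cnorm_sum f h l :
  (forall i, In i l -> Cnorm (f i) <= h i) -> Cnorm (Csum_list f l) <= Rsum_list h l.
Proof.
  induction l as [|i l IH]; simpl; intros H; [rewrite Cnorm_C0; lra|].
  eapply Rle_trans; [apply Cnorm_add|]. apply Rplus_le_compat; auto.
Qed.

Lemma Rsum_le h k l : (forall i, In i l -> h i <= k i) -> Rsum_list h l <= Rsum_list k l.
Proof.
  induction l as [|i l IH]; simpl; intros H; [lra|]. apply Rplus_le_compat; auto.
Qed.

Lemma Rsum_app h l l' : Rsum_list h (l ++ l') = Rsum_list h l + Rsum_list h l'.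
Proof. induction l as [|i l IH]; simpl; [ring|]. rewrite IH. ring. Qed.

Lemma Rsum_scal c h l : Rsum_list (fun i => c * h i) l = c * Rsum_list h l.
Proof. induction l as [|i l IH]; simpl; [ring|]. rewrite IH. ring. Qed.

Lemma Rsum_ge0 h l : (forall i, In i l -> 0 <= h i) -> 0 <= Rsum_list h l.
Proof.
  induction l as [|i l IH]; simpl; intros H; [lra|].
  pose proof (H i ltac:(auto)). pose proof (IH ltac:(auto)). lra.
Qed.

Lemma perm_incl_split l l' : NoDup l -> NoDup l' -> incl l l' ->
  Permutation l' (l ++ filter (fun x => asb (~ In x l)) l').
Proof.
  intros H H' Hi. apply NoDup_Permutation; auto.
  - apply NoDup_app; auto.
    + apply NoDup_filter; auto.
    + intros x Hx Hf. apply filter_In in Hf. destruct Hf as [_ Hf].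
      apply (proj1 (asbP _)) in Hf. contradiction.
  - intros x. rewrite in_app_iff, filter_In, asbP. split.
    + intros Hx. destruct (excluded_middle_informative (In x l)); auto.
    + intros [Hx|[Hx _]]; auto.
Qed.

Lemma Csum_incl_split f l l' : NoDup l -> NoDup l' -> incl l l' ->
  Csum_list f l' =
    Cadd (Csum_list f l) (Csum_list f (filter (fun x => asb (~ In x l)) l')).
Proof.
  intros H H' Hi. rewrite (Csum_perm f _ _ (perm_incl_split l l' H H' Hi)).
  apply Csum_app.
Qed.

(** Each element of [l] uses up one occurrence in [l'], so [l'] may repeat entries, as the lists
    [box] below do. *)
Lemma Rsum_incl h l l' : (forall i, In i l' -> 0 <= h i) -> NoDup l -> incl l l' ->
  Rsum_list h l <= Rsum_list h l'.
Proof.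
  intros Hp Hl. revert l' Hp. induction Hl as [|x l Hx Hl IH]; simpl; intros l' Hp Hi.
  - apply Rsum_ge0; auto.
  - destruct (in_split x l') as (l1 & l2 & ->); [apply Hi; left; auto|].
    assert (Rsum_list h l <= Rsum_list h (l1 ++ l2)).
    { apply IH.
      - intros i Hin. apply Hp. rewrite in_app_iff in *. simpl. tauto.
      - intros y Hy. specialize (Hi y (or_intror Hy)).
        rewrite in_app_iff in *. simpl in Hi.
        destruct Hi as [|[E|]]; auto. subst. contradiction. }
    rewrite Rsum_app in *. simpl. lra.
Qed.
End Sums.

Lemma Csum_map {I J : Type} (g : J -> I) (f : I -> Cx) l :
  Csum_list f (map g l) = Csum_list (fun j => f (g j)) l.
Proof. induction l as [|i l IH]; simpl; congruence. Qed.

Lemma Rsum_map {I J : Type} (g : J -> I) (f : I -> R) l :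
  Rsum_list f (map g l) = Rsum_list (fun j => f (g j)) l.
Proof. induction l as [|i l IH]; simpl; congruence. Qed.

Lemma Csum_swap {I J : Type} (f : I -> J -> Cx) l l' :
  Csum_list (fun i => Csum_list (f i) l') l =
  Csum_list (fun j => Csum_list (fun i => f i j) l) l'.
Proof.
  induction l as [|i l IH]; simpl; [symmetry; apply Csum_zero|].
  rewrite IH, Csum_add. reflexivity.
Qed.

(** * Formal sums and their weighted norms *)

Notation V := (nat -> R).
(** An element of the monoid algebra as an uncollected list of terms; the same vector may occur
    several times, and only the values [ev phi] carry meaning. *)
Definition Poly := list (Cx * V).

Definition ev (phi : V -> Cx) (p : Poly) : Cx :=
  Csum_list (fun t => Cmul (fst t) (phi (snd t))) p.

Definition padd (p q : Poly) : Poly := p ++ q.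
Definition popp (p : Poly) : Poly := map (fun t => (Copp (fst t), snd t)) p.
Definition pmul (p q : Poly) : Poly :=
  flat_map (fun t => map (fun u => (Cmul (fst t) (fst u), vadd (snd t) (snd u))) q) p.
Definition pone : Poly := [(C1, vzero)].
Definition pzero : Poly := [].
Fixpoint ppow (p : Poly) (n : nat) : Poly :=
  match n with O => pone | S k => pmul p (ppow p k) end.

(** Testing against all functionals, in particular indicators of single vectors, amounts to equality
    of the collected coefficients. *)
Definition peq (p q : Poly) : Prop := forall phi, ev phi p = ev phi q.

Notation psub p q := (padd p (popp q)).

Lemma vadd_comm x y : vadd x y = vadd y x.
Proof. apply functional_extensionality. intros i. unfold vadd. ring. Qed.

Lemma vadd_assoc x y z : vadd x (vadd y z) = vadd (vadd x y) z.
Proof. apply functional_extensionality. intros i. unfold vadd. ring. Qed.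

Lemma vadd_zero_l x : vadd vzero x = x.
Proof. apply functional_extensionality. intros i. unfold vadd, vzero. ring. Qed.

Lemma vadd_zero_r x : vadd x vzero = x.
Proof. rewrite vadd_comm. apply vadd_zero_l. Qed.

Lemma ev_ext phi psi p : (forall t, In t p -> phi (snd t) = psi (snd t)) ->
  ev phi p = ev psi p.
Proof. intros H. apply Csum_ext. intros t Ht. rewrite H; auto. Qed.

Lemma ev_padd phi p q : ev phi (padd p q) = Cadd (ev phi p) (ev phi q).
Proof. apply Csum_app. Qed.

Lemma ev_popp phi p : ev phi (popp p) = Copp (ev phi p).
Proof.
  unfold ev, popp. induction p as [|t p IH]; simpl; [ring|].
  rewrite IH. ring.
Qed.

Lemma ev_pone phi : ev phi pone = phi vzero.
Proof. unfold ev; simpl. ring. Qed.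

Lemma ev_pzero phi : ev phi pzero = C0.
Proof. reflexivity. Qed.

Lemma ev_scal c phi p : ev (fun x => Cmul c (phi x)) p = Cmul c (ev phi p).
Proof.
  unfold ev. rewrite <- Csum_scal. apply Csum_ext. intros. ring.
Qed.

Lemma ev_add phi psi p :
  ev (fun x => Cadd (phi x) (psi x)) p = Cadd (ev phi p) (ev psi p).
Proof.
  unfold ev. rewrite <- Csum_add. apply Csum_ext. intros. ring.
Qed.

Lemma ev_sum {I : Type} (f : I -> V -> Cx) l p :
  ev (fun x => Csum_list (fun i => f i x) l) p = Csum_list (fun i => ev (f i) p) l.
Proof.
  unfold ev. rewrite <- Csum_swap. apply Csum_ext. intros t _.
  rewrite Csum_scal. reflexivity.
Qed.

Lemma ev_pmul phi p q :
  ev phi (pmul p q) = ev (fun x => ev (fun y => phi (vadd x y)) q) p.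
Proof.
  unfold ev, pmul. induction p as [|t p IH]; simpl; [reflexivity|].
  rewrite Csum_app, IH, Csum_map. f_equal. simpl.
  rewrite <- Csum_scal. apply Csum_ext. intros. ring.
Qed.

Lemma ev_swap (f : V -> V -> Cx) p q :
  ev (fun x => ev (f x) q) p = ev (fun y => ev (fun x => f x y) p) q.
Proof.
  unfold ev at 1. transitivity
    (Csum_list (fun t => ev (fun y => Cmul (fst t) (f (snd t) y)) q) p).
  - apply Csum_ext. intros t _. rewrite <- ev_scal. reflexivity.
  - rewrite <- ev_sum. reflexivity.
Qed.

Arguments ev : simpl never.
Arguments padd : simpl never.
Arguments popp : simpl never.
Arguments pmul : simpl never.
Arguments pone : simpl never.

#[export] Instance peq_equiv : Equivalence peq.
Proof.
  split; unfold peq.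
  - intros p phi. reflexivity.
  - intros p q H phi. symmetry. apply H.
  - intros p q r H1 H2 phi. rewrite H1. apply H2.
Qed.

#[export] Instance padd_proper : Proper (peq ==> peq ==> peq) padd.
Proof. intros p p' Hp q q' Hq phi. rewrite !ev_padd, Hp, Hq. reflexivity. Qed.

#[export] Instance popp_proper : Proper (peq ==> peq) popp.
Proof. intros p p' Hp phi. rewrite !ev_popp, Hp. reflexivity. Qed.

#[export] Instance pmul_proper : Proper (peq ==> peq ==> peq) pmul.
Proof.
  intros p p' Hp q q' Hq phi. rewrite !ev_pmul, Hp. apply ev_ext. intros. apply Hq.
Qed.

(** By [ev_pmul] each law becomes an identity of iterated evaluations: commutativity is an exchange
    of two finite sums, associativity that of [vadd]. *)
Lemma Poly_ring : ring_theory pzero pone padd pmul (fun p q => psub p q) popp peq.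
Proof.
  constructor; intros; intro phi;
    rewrite ?ev_padd, ?ev_popp, ?ev_pmul, ?ev_padd, ?ev_popp, ?ev_pone, ?ev_pzero;
    try ring.
  - apply ev_ext. intros. rewrite vadd_zero_l. reflexivity.
  - rewrite ev_swap. apply ev_ext. intros. apply ev_ext. intros.
    rewrite vadd_comm. reflexivity.
  - apply ev_ext. intros. rewrite ev_pmul. apply ev_ext. intros. apply ev_ext. intros.
    rewrite vadd_assoc. reflexivity.
Qed.

Lemma Poly_ring_ext : ring_eq_ext padd pmul popp peq.
Proof. constructor; [exact padd_proper|exact pmul_proper|exact popp_proper]. Qed.

Add Ring Poly_ring : Poly_ring (setoid peq_equiv Poly_ring_ext).

Lemma ppow_pmul p q n : peq (ppow (pmul p q) n) (pmul (ppow p n) (ppow q n)).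
Proof. induction n as [|n IH]; simpl; [ring|]. rewrite IH. ring. Qed.

#[export] Instance ppow_proper : Proper (peq ==> eq ==> peq) ppow.
Proof.
  intros p q H n _ <-. induction n as [|n IH]; simpl; [reflexivity|].
  apply pmul_proper; assumption.
Qed.

(** * Characters, supports and geometric sums *)

Definition character (phi : V -> Cx) : Prop :=
  phi vzero = C1 /\ forall x y, phi (vadd x y) = Cmul (phi x) (phi y).

Lemma ev_char_pmul phi p q : character phi ->
  ev phi (pmul p q) = Cmul (ev phi p) (ev phi q).
Proof.
  intros [_ H]. rewrite ev_pmul.
  transitivity (ev (fun x => Cmul (ev phi q) (phi x)) p).
  - apply ev_ext. intros t _.
    transitivity (ev (fun y => Cmul (phi (snd t)) (phi y)) q).
    + apply ev_ext. intros. apply H.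
    + rewrite ev_scal. ring.
  - rewrite ev_scal. ring.
Qed.

Lemma ev_char_ppow_norm phi p n : character phi ->
  Cnorm (ev phi (ppow p n)) = Cnorm (ev phi p) ^ n.
Proof.
  intros H. induction n as [|n IH]; simpl.
  - rewrite ev_pone. destruct H as [-> _]. apply Cnorm_C1.
  - rewrite ev_char_pmul, Cnorm_mul, IH by assumption. reflexivity.
Qed.

Definition supp (S : V -> Prop) (p : Poly) : Prop := Forall (fun t => S (snd t)) p.

Section Support.
Variable S : V -> Prop.
Hypothesis S0 : S vzero.
Hypothesis SD : forall x y, S x -> S y -> S (vadd x y).

Lemma supp_padd p q : supp S p -> supp S q -> supp S (padd p q).
Proof. intros. apply Forall_app; auto. Qed.

Lemma supp_popp p : supp S p -> supp S (popp p).
Proof. intros H. apply Forall_map. exact H. Qed.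

Lemma supp_pone : supp S pone.
Proof. repeat constructor. exact S0. Qed.

Lemma supp_pmul p q : supp S p -> supp S q -> supp S (pmul p q).
Proof.
  unfold supp. rewrite !Forall_forall. intros Hp Hq t Ht.
  apply in_flat_map in Ht. destruct Ht as (u & Hu & Ht).
  apply in_map_iff in Ht. destruct Ht as (v & <- & Hv). simpl. auto.
Qed.

Lemma supp_ppow p n : supp S p -> supp S (ppow p n).
Proof.
  intros H. induction n; simpl; [apply supp_pone|apply supp_pmul; auto].
Qed.
End Support.

(** The sum of [p ^ (n - 1 - j) * (- r) ^ j] over [j < n], the cofactor of [p + r] in
    [p ^ n - (- r) ^ n]. *)
Fixpoint geom (p r : Poly) (n : nat) : Poly :=
  match n with
  | O => pzero
  | S k => padd (pmul p (geom p r k)) (ppow (popp r) k)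
  end.

Lemma geom_spec p r n :
  peq (pmul (padd p r) (geom p r n)) (psub (ppow p n) (ppow (popp r) n)).
Proof.
  induction n as [|n IH]; simpl; [ring|].
  transitivity (padd (pmul p (pmul (padd p r) (geom p r n)))
                     (pmul (padd p r) (ppow (popp r) n))); [ring|].
  rewrite IH. ring.
Qed.

Lemma supp_geom (S : V -> Prop) p r n :
  S vzero -> (forall x y, S x -> S y -> S (vadd x y)) ->
  supp S p -> supp S r -> supp S (geom p r n).
Proof.
  intros S0 SD Hp Hr. induction n; simpl; [constructor|].
  apply supp_padd; [apply supp_pmul; auto|].
  apply supp_ppow; auto. apply supp_popp; auto.
Qed.

(** [nle S v p M] says that the norm of [p] in the [l^1] space on [S] with weight [v] is
    at most [M]; the norm is described by duality, so that it is visibly compatible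
    with [peq] although [p] may list a vector several times. *)
Definition nle (S : V -> Prop) (v : V -> R) (p : Poly) (M : R) : Prop :=
  forall phi c, 0 <= c -> (forall x, S x -> Cnorm (phi x) <= c * v x) ->
    Cnorm (ev phi p) <= c * M.

#[export] Instance nle_proper S v : Proper (peq ==> eq ==> iff) (nle S v).
Proof.
  intros p q H M _ <-. unfold nle.
  split; intros Hn phi c Hc Hphi; [rewrite <- H|rewrite H]; auto.
Qed.

Section Norm.
Variables (S : V -> Prop) (v : V -> R).
Hypothesis S0 : S vzero.
Hypothesis SD : forall x y, S x -> S y -> S (vadd x y).
Hypothesis v_pos : forall x, S x -> 0 < v x.
Hypothesis v0 : v vzero = 1.
Hypothesis vD : forall x y, S x -> S y -> v (vadd x y) <= v x * v y.
Implicit Types (p q r : Poly) (M : R).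

Lemma nle_mono p M M' : M <= M' -> nle S v p M -> nle S v p M'.
Proof.
  intros HM H phi c Hc Hphi. eapply Rle_trans; [apply H; eauto|].
  apply Rmult_le_compat_l; auto.
Qed.

Lemma nle_ge0 p M : nle S v p M -> 0 <= M.
Proof.
  intros H. specialize (H (fun _ => C0) 1 ltac:(lra)).
  assert (Cnorm (ev (fun _ => C0) p) <= 1 * M).
  { apply H. intros x Hx. rewrite Cnorm_C0. pose proof (v_pos x Hx). lra. }
  pose proof (Cnorm_ge0 (ev (fun _ => C0) p)). lra.
Qed.

Lemma nle_padd p q M N : nle S v p M -> nle S v q N -> nle S v (padd p q) (M + N).
Proof.
  intros Hp Hq phi c Hc Hphi. rewrite ev_padd.
  eapply Rle_trans; [apply Cnorm_add|].
  specialize (Hp phi c Hc Hphi). specialize (Hq phi c Hc Hphi). lra.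
Qed.

Lemma nle_popp p M : nle S v p M -> nle S v (popp p) M.
Proof. intros Hp phi c Hc Hphi. rewrite ev_popp, Cnorm_opp. auto. Qed.

Lemma nle_psub p q M N : nle S v p M -> nle S v q N -> nle S v (psub p q) (M + N).
Proof. intros. apply nle_padd; auto using nle_popp. Qed.

Lemma nle_pone : nle S v pone 1.
Proof.
  intros phi c Hc Hphi. rewrite ev_pone. specialize (Hphi vzero S0). rewrite v0 in Hphi. lra.
Qed.

Lemma nle_pzero : nle S v pzero 0.
Proof. intros phi c Hc Hphi. rewrite ev_pzero, Cnorm_C0. lra. Qed.

(** The dual norm is tested twice: for fixed [x] the function [phi (vadd x y)] of [y] is bounded by
    [(c * v x) * v y], so evaluating it on [q] leaves a function of [x] bounded by
    [(c * N) * v x]. *)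
Lemma nle_pmul p q M N : nle S v p M -> nle S v q N -> nle S v (pmul p q) (M * N).
Proof.
  intros Hp Hq phi c Hc Hphi. pose proof (nle_ge0 q N Hq) as HN. rewrite ev_pmul.
  replace (c * (M * N)) with ((c * N) * M) by ring. apply Hp; [nra|].
  intros x Hx. replace (c * N * v x) with ((c * v x) * N) by ring.
  pose proof (v_pos x Hx). apply Hq; [nra|].
  intros y Hy. eapply Rle_trans; [apply Hphi; auto|].
  rewrite Rmult_assoc. apply Rmult_le_compat_l; auto.
Qed.

Lemma nle_ppow p M n : nle S v p M -> nle S v (ppow p n) (M ^ n).
Proof.
  intros H. induction n; simpl; [apply nle_pone|apply nle_pmul; auto].
Qed.

Fixpoint geom_bound (M N : R) (n : nat) : R :=
  match n with O => 0 | Datatypes.S k => M * geom_bound M N k + N ^ k end.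

Lemma nle_geom p r M N n : nle S v p M -> nle S v r N ->
  nle S v (geom p r n) (geom_bound M N n).
Proof.
  intros Hp Hr. induction n; simpl; [apply nle_pzero|].
  apply nle_padd; [apply nle_pmul; auto|]. apply nle_ppow, nle_popp; auto.
Qed.

Lemma nle_list p : supp S p ->
  nle S v p (Rsum_list (fun t => Cnorm (fst t) * v (snd t)) p).
Proof.
  intros Hs phi c Hc Hphi. unfold ev. rewrite <- Rsum_scal. apply Cnorm_sum.
  intros t Ht. rewrite Cnorm_mul. unfold supp in Hs. rewrite Forall_forall in Hs.
  specialize (Hphi _ (Hs t Ht)). pose proof (Cnorm_ge0 (fst t)). nra.
Qed.

Lemma nle_exists p : supp S p -> exists M, nle S v p M.
Proof. eexists. apply nle_list. assumption. Qed.

(** By telescoping, only the sizes of [Q ~ p ^ - N] and of [r ^ N] matter. *)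
Lemma nle_perturb p r Q N rho B eps : nle S v r rho -> nle S v Q B ->
  nle S v (psub (pmul (ppow p N) Q) pone) eps ->
  nle S v (psub (pmul (padd p r) (pmul (geom p r N) Q)) pone) (eps + rho ^ N * B).
Proof.
  intros Hr HQ H.
  assert (E : peq (psub (pmul (padd p r) (pmul (geom p r N) Q)) pone)
    (psub (psub (pmul (ppow p N) Q) pone) (pmul (ppow (popp r) N) Q))).
  { transitivity (psub (pmul (pmul (padd p r) (geom p r N)) Q) pone); [ring|].
    rewrite geom_spec. ring. }
  rewrite E. apply nle_psub; auto. apply nle_pmul; auto. apply nle_ppow, nle_popp; auto.
Qed.

(** With [e = 1 - p q] this is [q (1 + e + ... + e ^ (n - 1))], a partial Neumann series for the
    inverse of [p]. *)
Definition neumann (p q : Poly) (n : nat) : Poly :=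
  pmul q (geom pone (popp (psub pone (pmul p q))) n).

Lemma neumann_spec p q n :
  peq (psub (pmul p (neumann p q n)) pone) (popp (ppow (psub pone (pmul p q)) n)).
Proof.
  unfold neumann. set (e := psub pone (pmul p q)).
  assert (E : peq (pmul p q) (padd pone (popp e))) by (unfold e; ring).
  transitivity (psub (pmul (pmul p q) (geom pone (popp e) n)) pone); [ring|].
  rewrite E, geom_spec.
  assert (E1 : peq (ppow pone n) pone).
  { induction n as [|n IH]; simpl; [reflexivity|]. rewrite IH. ring. }
  assert (E2 : peq (popp (popp e)) e) by ring.
  rewrite E1, E2. ring.
Qed.

Lemma nle_one_sub p q eps : nle S v (psub (pmul p q) pone) eps ->
  nle S v (psub pone (pmul p q)) eps.
Proof.
  intros H. assert (E : peq (psub pone (pmul p q)) (popp (psub (pmul p q) pone))) by ring.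
  rewrite E. apply nle_popp, H.
Qed.

Lemma nle_neumann_err p q eps n : nle S v (psub (pmul p q) pone) eps ->
  nle S v (psub (pmul p (neumann p q n)) pone) (eps ^ n).
Proof.
  intros H. rewrite neumann_spec. apply nle_popp, nle_ppow, nle_one_sub, H.
Qed.

Lemma geom_bound_half n : geom_bound 1 (/ 2) n <= 2 - 2 * (/ 2) ^ n.
Proof. induction n as [|n IH]; simpl; lra. Qed.

(** The factor [2] sums the geometric series of ratio [/ 2]. It does not depend on [n], so precision
    improves while the norm stays bounded. *)
Lemma nle_neumann p q B n : nle S v (psub (pmul p q) pone) (/ 2) -> nle S v q B ->
  nle S v (neumann p q n) (B * 2).
Proof.
  intros H Hq. apply nle_pmul; auto. apply (nle_mono _ (geom_bound 1 (/ 2) n)).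
  - pose proof (geom_bound_half n). pose proof (pow_le (/ 2) n ltac:(lra)). lra.
  - apply nle_geom; [apply nle_pone|]. apply nle_popp, nle_one_sub, H.
Qed.

Lemma supp_neumann p q n : supp S p -> supp S q -> supp S (neumann p q n).
Proof.
  intros Hp Hq. apply supp_pmul; auto. apply supp_geom; auto.
  - apply supp_pone; auto.
  - apply supp_popp, supp_padd; [apply supp_pone; auto|].
    apply supp_popp, supp_pmul; auto.
Qed.

(** Since [p ^ (n + 1) - 1 = (p - 1) (p ^ n - 1) + (p ^ n - 1) + (p - 1)] and [y <= 1], each factor
    at most doubles the error and adds [y]. *)
Lemma nle_ppow_near_one p y n : y <= 1 -> nle S v (psub p pone) y ->
  nle S v (psub (ppow p n) pone) (2 ^ n * y).
Proof.
  intros Hy H. pose proof (nle_ge0 _ _ H) as Hy0.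
  (* The induction needs the sharper constant, which leaves room for the added [y]. *)
  apply (nle_mono _ ((2 ^ n - 1) * y)); [lra|].
  induction n as [|n IH].
  - simpl. assert (E : peq (psub pone pone) pzero) by ring. rewrite E.
    apply (nle_mono _ 0); [lra|apply nle_pzero].
  - simpl. assert (E : peq (psub (pmul p (ppow p n)) pone)
      (padd (padd (pmul (psub p pone) (psub (ppow p n) pone)) (psub (ppow p n) pone))
        (psub p pone))) by ring.
    rewrite E. apply (nle_mono _ (y * ((2 ^ n - 1) * y) + (2 ^ n - 1) * y + y)).
    + pose proof (pow_R1_Rle 2 n ltac:(lra)).
      assert (0 <= (2 ^ n - 1) * y) by nra. nra.
    + apply nle_padd; [apply nle_padd; [apply nle_pmul|]|]; auto.
Qed.

(** The [N]-th power of a sufficiently precise Neumann inverse works, at the cost of a factor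
    [2 ^ N] in the error. The norm of [Q] is left open here; it is controlled later through values
    on vertical lines. *)
Lemma approx_inverse_pow p q : supp S p -> supp S q ->
  nle S v (psub (pmul p q) pone) (/ 2) ->
  forall N eps, 0 < eps ->
  exists Q, supp S Q /\ nle S v (psub (pmul (ppow p N) Q) pone) eps.
Proof.
  intros Hp Hq H N eps He.
  assert (H2 : 0 < 2 ^ N) by (apply pow_lt; lra).
  destruct (pow_lt_1_zero (/ 2) ltac:(rewrite Rabs_pos_eq; lra) (Rmin 1 (eps / 2 ^ N)))
    as [n Hn].
  { apply Rmin_glb_lt; [lra|]. apply Rdiv_lt_0_compat; auto. }
  specialize (Hn n (le_n n)). pose proof (pow_le (/ 2) n ltac:(lra)) as Hn0.
  rewrite Rabs_pos_eq in Hn by auto.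
  pose proof (Rmin_l 1 (eps / 2 ^ N)). pose proof (Rmin_r 1 (eps / 2 ^ N)).
  exists (ppow (neumann p q n) N). split; [apply supp_ppow; auto; apply supp_neumann; auto|].
  rewrite <- ppow_pmul.
  apply (nle_mono _ (2 ^ N * (/ 2) ^ n)).
  - apply (Rmult_le_reg_r (/ 2 ^ N)); [apply Rinv_0_lt_compat; auto|].
    replace (2 ^ N * (/ 2) ^ n * / 2 ^ N) with ((/ 2) ^ n) by (field; lra).
    unfold Rdiv in *. lra.
  - apply nle_ppow_near_one; [lra|]. apply nle_neumann_err, H.
Qed.

End Norm.

(** * Recovering coefficients from values on a vertical line *)

Fixpoint rdot (r : nat) (x t : V) : R :=
  match r with O => 0 | S k => rdot k x t + x k * t k end.

Definition vsum (r : nat) (x : V) : R := rdot r x (fun _ => 1).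

Definition vanishing_from (r : nat) (x : V) : Prop := forall i, (r <= i)%nat -> x i = 0.

Lemma rdot_vadd_l r x y t : rdot r (vadd x y) t = rdot r x t + rdot r y t.
Proof. induction r as [|r IH]; simpl; [ring|]. rewrite IH. unfold vadd. ring. Qed.

Lemma rdot_vadd_r r x t u : rdot r x (vadd t u) = rdot r x t + rdot r x u.
Proof. induction r as [|r IH]; simpl; [ring|]. rewrite IH. unfold vadd. ring. Qed.

Lemma rdot_vzero_l r t : rdot r vzero t = 0.
Proof. induction r as [|r IH]; simpl; [ring|]. rewrite IH. unfold vzero. ring. Qed.

Lemma rdot_vzero_r r x : rdot r x vzero = 0.
Proof. induction r as [|r IH]; simpl; [ring|]. rewrite IH. unfold vzero. ring. Qed.

Lemma rdot_vscal_l r k x t : rdot r (vscal k x) t = k * rdot r x t.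
Proof. induction r as [|r IH]; simpl; [ring|]. rewrite IH. unfold vscal. ring. Qed.

Lemma rdot_const_r r x s : rdot r x (fun _ => s) = s * vsum r x.
Proof.
  unfold vsum. induction r as [|r IH]; simpl; [ring|]. rewrite IH. ring.
Qed.

Lemma dotC_rdot r x s :
  dotC r x s = (rdot r x (fun i => fst (s i)), rdot r x (fun i => snd (s i))).
Proof.
  induction r as [|r IH]; simpl; [reflexivity|]. rewrite IH.
  unfold Cadd, Cmul, RtoC; simpl. f_equal; ring.
Qed.

Lemma rdot_ge0 r x t : (forall i, (i < r)%nat -> 0 <= x i) ->
  (forall i, (i < r)%nat -> 0 <= t i) -> 0 <= rdot r x t.
Proof.
  induction r as [|r IH]; simpl; intros H Ht; [lra|].
  assert (0 <= rdot r x t) by auto.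
  pose proof (H r ltac:(lia)). pose proof (Ht r ltac:(lia)). nra.
Qed.

Lemma vsum_gt0 r x : (forall i, (i < r)%nat -> 0 <= x i) -> vanishing_from r x ->
  x <> vzero -> 0 < vsum r x.
Proof.
  intros H Hv Hx. apply Rnot_le_lt. intros Hle. apply Hx.
  apply functional_extensionality. intros i. unfold vzero.
  destruct (Nat.lt_ge_cases i r) as [Hi|Hi]; [|auto].
  clear Hv Hx. unfold vsum in Hle. induction r as [|r IH]; [lia|].
  simpl in Hle.
  assert (0 <= rdot r x (fun _ => 1)) by (apply rdot_ge0; [auto|intros; lra]).
  pose proof (H r ltac:(lia)).
  destruct (Nat.eq_dec i r) as [->|Hn]; [lra|]. apply IH; [auto|lra|lia].
Qed.

Lemma vsum_ge0 r x : (forall i, (i < r)%nat -> 0 <= x i) -> 0 <= vsum r x.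
Proof. intros H. apply rdot_ge0; auto. intros; lra. Qed.

Lemma rdot_single r x i c : rdot r x (fun j => if Nat.eq_dec j i then c else 0) =
  if Nat.ltb i r then x i * c else 0.
Proof.
  induction r as [|r IH]; simpl; [reflexivity|]. rewrite IH.
  destruct (Nat.eq_dec r i) as [->|Hn].
  - rewrite Nat.ltb_irrefl, (proj2 (Nat.ltb_lt i (S i))) by lia. ring.
  - destruct (Nat.ltb_spec i r), (Nat.ltb_spec i (S r)); try lia; ring.
Qed.

(** The vectors differ in some coordinate, necessarily below [r]; a multiple of that basis vector
    produces the phase [PI]. *)
Lemma separating_direction r x y : vanishing_from r x -> vanishing_from r y -> x <> y ->
  exists t, rdot r y t - rdot r x t = PI.
Proof.
  intros Hx Hy Hn.
  destruct (excluded_middle_informative (exists i, x i <> y i)) as [[i Hi]|H].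
  - exists (fun j => if Nat.eq_dec j i then PI / (y i - x i) else 0).
    rewrite !rdot_single. destruct (Nat.ltb_spec i r).
    + field. lra.
    + rewrite Hx, Hy in Hi by assumption. lra.
  - exfalso. apply Hn. apply functional_extensionality. intros i.
    destruct (Req_dec (x i) (y i)); auto. exfalso. eauto.
Qed.

(** The exponential [e ^ (- x . s)] at the purely imaginary point [s = i t]. *)
Definition wave (r : nat) (t x : V) : Cx := cis (- rdot r x t).

Lemma wave_character r t : character (wave r t).
Proof.
  split; intros; unfold wave.
  - rewrite rdot_vzero_l, Ropp_0. apply cis_0.
  - rewrite rdot_vadd_l, <- cis_add. f_equal. ring.
Qed.

Lemma Cnorm_wave r t x : Cnorm (wave r t x) = 1.
Proof. apply Cnorm_cis. Qed.

Lemma wave_vadd r t u x : wave r (vadd t u) x = Cmul (wave r t x) (wave r u x).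
Proof. unfold wave. rewrite rdot_vadd_r, <- cis_add. f_equal. ring. Qed.

Definition vdelta (x y : V) : Cx := if eqdec_classic y x then C1 else C0.

Lemma vdelta_eq x : vdelta x x = C1.
Proof. unfold vdelta. destruct (eqdec_classic x x); congruence. Qed.

Lemma vdelta_neq x y : y <> x -> vdelta x y = C0.
Proof. unfold vdelta. destruct (eqdec_classic y x); congruence. Qed.

Definition coef (x : V) (p : Poly) : Cx := ev (vdelta x) p.

Section CoefficientBound.
Variables (r : nat) (q : Poly) (B : R).
Hypothesis q_supp : supp (vanishing_from r) q.
Hypothesis q_bound : forall t, Cnorm (ev (wave r t) q) <= B.

(** Averaging [phi] with a unimodular multiple of [phi * wave v] keeps the bound and the value
    at [x] and kills [y] when [v] separates [x] from [y] by a phase of [PI]. *)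
Lemma isolate_point x D : vanishing_from r x ->
  (forall y, In y D -> y <> x /\ vanishing_from r y) ->
  exists phi, phi x = C1 /\ (forall y, In y D -> phi y = C0) /\
    forall t, Cnorm (ev (fun z => Cmul (phi z) (wave r t z)) q) <= B.
Proof.
  intros Hx. induction D as [|y D IH]; intros HD.
  - exists (fun _ => C1). split; [reflexivity|]. split; [intros y []|].
    intros t. erewrite ev_ext; [apply (q_bound t)|]. intros; simpl. ring.
  - destruct IH as (phi & Hphix & HphiD & Hphi); [intros; apply HD; right; auto|].
    destruct (HD y (or_introl eq_refl)) as [Hyx Hy].
    destruct (separating_direction r x y Hx Hy ltac:(auto)) as [v Hv].
    (* This factor cancels the phase of [wave r v] at [x], so the average keeps the value [1]
       there. *)
    set (c := cis (rdot r x v)).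
    exists (fun z => Cmul (RtoC (/ 2)) (Cadd (phi z) (Cmul c (Cmul (phi z) (wave r v z))))).
    assert (H2 : Cmul (RtoC (/ 2)) (Cadd C1 C1) = C1).
    { unfold Cmul, RtoC, Cadd, C1; simpl. f_equal; field. }
    assert (Hc : forall z, Cmul c (wave r v z) = cis (rdot r x v - rdot r z v)).
    { intros z. unfold c, wave. rewrite <- cis_add. f_equal. }
    split; [|split].
    + rewrite Hphix. transitivity (Cmul (RtoC (/ 2)) (Cadd C1 (Cmul c (wave r v x)))); [ring|].
      rewrite Hc. replace (rdot r x v - rdot r x v) with 0 by ring. rewrite cis_0. exact H2.
    + intros z [<-|Hz].
      * transitivity (Cmul (Cmul (RtoC (/ 2)) (phi y)) (Cadd C1 (Cmul c (wave r v y)))); [ring|].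
        rewrite Hc. replace (rdot r x v - rdot r y v) with (- PI) by lra.
        replace (cis (- PI)) with (Copp C1); [ring|].
        unfold cis, Copp, C1; simpl. rewrite cos_neg, sin_neg, cos_PI, sin_PI. reflexivity.
      * rewrite HphiD by assumption. ring.
    + intros t.
      rewrite (ev_ext _ (fun z => Cmul (RtoC (/ 2))
        (Cadd (Cmul (phi z) (wave r t z)) (Cmul c (Cmul (phi z) (wave r (vadd t v) z)))))).
      * rewrite ev_scal, ev_add, ev_scal, Cnorm_mul, Cnorm_RtoC, Rabs_pos_eq by lra.
        pose proof (Hphi t). pose proof (Hphi (vadd t v)).
        pose proof (Cnorm_add (ev (fun z => Cmul (phi z) (wave r t z)) q)
          (Cmul c (ev (fun z => Cmul (phi z) (wave r (vadd t v) z)) q))) as H3.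
        rewrite Cnorm_mul in H3. unfold c in H3 at 2. rewrite Cnorm_cis in H3. lra.
      * intros u _. rewrite wave_vadd. ring.
Qed.

(** Isolating [x] from the finitely many other vectors listed in [q] gives a [phi] that acts on [q]
    as the indicator of [x]; the bound at [t = 0] is then the claim. Finitely many averages thus
    replace a Bohr mean. *)
Lemma coef_le_sup x : vanishing_from r x -> Cnorm (coef x q) <= B.
Proof.
  intros Hx. set (D := filter (fun y => asb (y <> x)) (map snd q)).
  pose proof q_supp as Hs. unfold supp in Hs. rewrite Forall_forall in Hs.
  assert (HD : forall t, In t q -> snd t <> x -> In (snd t) D).
  { intros t Ht Hn. apply filter_In. split; [apply in_map; auto|]. apply asb_true; auto. }
  destruct (isolate_point x D Hx) as (phi & Hphix & HphiD & Hphi).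
  { intros y Hy. apply filter_In in Hy. destruct Hy as [Hy1 Hy2].
    apply (proj1 (asbP _)) in Hy2. split; auto.
    apply in_map_iff in Hy1. destruct Hy1 as (t & <- & Ht). auto. }
  specialize (Hphi vzero). unfold coef. erewrite ev_ext; [exact Hphi|].
  intros t Ht. simpl. unfold wave. rewrite rdot_vzero_r, Ropp_0, cis_0.
  destruct (eqdec_classic (snd t) x) as [E|E].
  - rewrite E, Hphix, vdelta_eq. ring.
  - rewrite vdelta_neq, HphiD by auto. ring.
Qed.
End CoefficientBound.

Lemma coef_out_of_supp S p x : supp S p -> ~ S x -> coef x p = C0.
Proof.
  intros Hs Hx. unfold coef. transitivity (ev (fun _ => Cmul C0 C0) p).
  - apply ev_ext. intros t Ht. unfold supp in Hs. rewrite Forall_forall in Hs.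
    rewrite vdelta_neq; [ring|]. intros E. apply Hx. rewrite <- E. auto.
  - rewrite (ev_scal C0 (fun _ => C0)). ring.
Qed.

Lemma Csum_vdelta (f : V -> Cx) l x : NoDup l ->
  Csum_list (fun y => Cmul (f y) (vdelta y x)) l = if asb (In x l) then f x else C0.
Proof.
  induction 1 as [|y l Hy Hl IH]; simpl.
  - rewrite asb_false; auto.
  - rewrite IH. destruct (eqdec_classic x y) as [->|E].
    + rewrite vdelta_eq, (asb_false (In y l)), asb_true by auto. ring.
    + rewrite vdelta_neq by auto. destruct (excluded_middle_informative (In x l)).
      * rewrite !asb_true by auto. ring.
      * rewrite !asb_false by (auto; intros [|]; auto). ring.
Qed.

Lemma ev_coef phi p l : NoDup l -> (forall t, In t p -> In (snd t) l) ->
  ev phi p = Csum_list (fun y => Cmul (phi y) (coef y p)) l.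
Proof.
  intros Hl Hp.
  transitivity (ev (fun x => Csum_list (fun y => Cmul (phi y) (vdelta y x)) l) p).
  - apply ev_ext. intros t Ht. rewrite Csum_vdelta, asb_true by auto. reflexivity.
  - rewrite ev_sum. apply Csum_ext. intros. apply ev_scal.
Qed.

(** The norm is at most the largest coefficient times the total weight of the support. This asks for
    a weight summable over [S], which is what damping will provide. *)
Lemma nle_of_coef S v q B K : supp S q -> 0 <= B ->
  (forall l, NoDup l -> (forall x, In x l -> S x) -> Rsum_list v l <= K) ->
  (forall x, S x -> Cnorm (coef x q) <= B) -> nle S v q (B * K).
Proof.
  intros Hs HB HK Hq phi c Hc Hphi. unfold supp in Hs. rewrite Forall_forall in Hs.
  set (l := nodup eqdec_classic (map snd q)).
  assert (Hl : NoDup l) by apply NoDup_nodup.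
  assert (HlS : forall x, In x l -> S x).
  { intros x Hx. apply nodup_In, in_map_iff in Hx. destruct Hx as (t & <- & Ht). auto. }
  rewrite (ev_coef phi q l); auto.
  2: { intros t Ht. apply nodup_In, in_map, Ht. }
  apply Rle_trans with (Rsum_list (fun x => (c * B) * v x) l).
  - apply Cnorm_sum. intros x Hx. rewrite Cnorm_mul.
    specialize (Hphi x (HlS x Hx)). specialize (Hq x (HlS x Hx)).
    pose proof (Cnorm_ge0 (phi x)). pose proof (Cnorm_ge0 (coef x q)).
    replace (c * B * v x) with ((c * v x) * B) by ring.
    apply Rmult_le_compat; auto.
  - rewrite Rsum_scal, <- Rmult_assoc. specialize (HK l Hl HlS).
    apply Rmult_le_compat_l; auto. apply Rmult_le_pos; auto.
Qed.

(** The dual norm is tested on the function that is the conjugate phase of the coefficient times [v]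
    on [l] and zero elsewhere. *)
Lemma sum_coef_le (S : V -> Prop) v p M l : nle S v p M -> NoDup l ->
  (forall x, S x -> 0 < v x) -> (forall x, In x l -> S x) ->
  Rsum_list (fun x => Cnorm (coef x p) * v x) l <= M.
Proof.
  intros Hp Hl Hv HlS.
  set (g := fun y => Cmul (Csign (coef y p)) (RtoC (v y))).
  assert (Hg : Cnorm (ev (fun x => Csum_list (fun y => Cmul (g y) (vdelta y x)) l) p) <= 1 * M).
  { apply Hp; [lra|]. intros x Hx. rewrite Csum_vdelta by assumption.
    pose proof (Hv x Hx). destruct (asb (In x l)).
    - unfold g. rewrite Cnorm_mul, Cnorm_RtoC, Rabs_pos_eq by lra.
      apply Rmult_le_compat_r; [lra|]. apply Cnorm_Csign.
    - rewrite Cnorm_C0. lra. }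
  rewrite ev_sum in Hg.
  assert (E : Csum_list (fun y => ev (fun x => Cmul (g y) (vdelta y x)) p) l =
    RtoC (Rsum_list (fun x => Cnorm (coef x p) * v x) l)).
  { clear -l. induction l as [|y l IH]; simpl; [reflexivity|].
    rewrite IH, ev_scal. fold (coef y p). unfold g.
    transitivity (Cadd (Cmul (RtoC (v y)) (Cmul (coef y p) (Csign (coef y p))))
      (RtoC (Rsum_list (fun x => Cnorm (coef x p) * v x) l))); [ring|].
    rewrite Cmul_Csign. unfold Cadd, Cmul, RtoC; simpl. f_equal; ring. }
  rewrite E, Cnorm_RtoC in Hg. pose proof (Rle_abs
    (Rsum_list (fun x => Cnorm (coef x p) * v x) l)). lra.
Qed.

Lemma coef_le (S : V -> Prop) v p M x : nle S v p M -> (forall x, S x -> 1 <= v x) -> S x ->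
  Cnorm (coef x p) <= M.
Proof.
  intros Hp Hv Hx. pose proof (sum_coef_le S v p M [x] Hp) as H.
  simpl in H. specialize (Hv x Hx) as Hv1. pose proof (Cnorm_ge0 (coef x p)).
  assert (Cnorm (coef x p) * v x + 0 <= M); [|nra].
  apply H.
  - repeat constructor. intros [].
  - intros y Hy. specialize (Hv y Hy). lra.
  - intros y [<-|[]]; auto.
Qed.

(** * Damping the coefficients *)

Section Twist.
Variable r : nat.

Definition tw (tau : R) (p : Poly) : Poly :=
  map (fun t => (Cmul (fst t) (RtoC (exp (- tau * vsum r (snd t)))), snd t)) p.

Lemma ev_tw phi tau p :
  ev phi (tw tau p) = ev (fun x => Cmul (RtoC (exp (- tau * vsum r x))) (phi x)) p.
Proof.
  unfold ev, tw. rewrite Csum_map. apply Csum_ext. intros; simpl. ring.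
Qed.

#[export] Instance tw_proper : Proper (eq ==> peq ==> peq) tw.
Proof. intros tau _ <- p q H phi. rewrite !ev_tw. apply H. Qed.

Lemma tw_padd tau p q : peq (tw tau (padd p q)) (padd (tw tau p) (tw tau q)).
Proof. intros phi. rewrite ev_padd, !ev_tw, ev_padd. reflexivity. Qed.

Lemma tw_popp tau p : peq (tw tau (popp p)) (popp (tw tau p)).
Proof. intros phi. rewrite ev_popp, !ev_tw, ev_popp. reflexivity. Qed.

Lemma vsum_vadd x y : vsum r (vadd x y) = vsum r x + vsum r y.
Proof. apply rdot_vadd_l. Qed.

Lemma tw_pone tau : peq (tw tau pone) pone.
Proof.
  intros phi. rewrite ev_tw, !ev_pone. unfold vsum. rewrite rdot_vzero_l, Rmult_0_r, exp_0.
  rewrite RtoC_1. ring.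
Qed.

Lemma tw_pmul tau p q : peq (tw tau (pmul p q)) (pmul (tw tau p) (tw tau q)).
Proof.
  intros phi. rewrite ev_pmul, !ev_tw, ev_pmul. apply ev_ext. intros t _.
  rewrite ev_tw, <- ev_scal. apply ev_ext. intros u _.
  rewrite vsum_vadd, Rmult_plus_distr_l, exp_plus, RtoC_mul. ring.
Qed.

Lemma tw_ppow tau p n : peq (tw tau (ppow p n)) (ppow (tw tau p) n).
Proof.
  induction n as [|n IH]; simpl; [apply tw_pone|]. rewrite tw_pmul, IH. reflexivity.
Qed.

Lemma tw_tw s tau p : peq (tw s (tw tau p)) (tw (s + tau) p).
Proof.
  intros phi. rewrite !ev_tw. apply ev_ext. intros t _.
  replace (- (s + tau) * vsum r (snd t)) with (- s * vsum r (snd t) + - tau * vsum r (snd t))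
    by ring.
  rewrite exp_plus, RtoC_mul. ring.
Qed.

Lemma supp_tw S tau p : supp S p -> supp S (tw tau p).
Proof. intros H. apply Forall_map. exact H. Qed.

(** Twisting [p] is the same as multiplying the test functional by the exponential, so only the
    ratio of the damped [v'] to [v] matters. *)
Lemma nle_tw S v v' tau p M D : 0 <= D ->
  (forall x, S x -> exp (- tau * vsum r x) * v' x <= D * v x) ->
  nle S v p M -> nle S v' (tw tau p) (D * M).
Proof.
  intros HD Hv Hp phi c Hc Hphi. rewrite ev_tw.
  replace (c * (D * M)) with ((c * D) * M) by ring.
  apply Hp; [apply Rmult_le_pos; auto|]. intros x Hx.
  pose proof (exp_pos (- tau * vsum r x)).
  rewrite Cnorm_mul, Cnorm_RtoC, Rabs_pos_eq by lra.
  specialize (Hphi x Hx). specialize (Hv x Hx).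
  apply Rle_trans with (exp (- tau * vsum r x) * (c * v' x)).
  - apply Rmult_le_compat_l; lra.
  - replace (exp (- tau * vsum r x) * (c * v' x))
      with (c * (exp (- tau * vsum r x) * v' x)) by ring.
    replace (c * D * v x) with (c * (D * v x)) by ring.
    apply Rmult_le_compat_l; auto.
Qed.

End Twist.

(** * Finitely generated monoids *)

(** One exponent per generator: a sum over the monoid is then dominated by a product of geometric
    series. *)
Fixpoint mon (gs : list V) (x : V) : Prop :=
  match gs with
  | [] => x = vzero
  | g :: gs => exists k y, mon gs y /\ x = vadd (vscal (INR k) g) y
  end.

Lemma vscal_0 x : vscal (INR 0) x = vzero.
Proof. apply functional_extensionality. intros i. unfold vscal, vzero. simpl. ring. Qed.

Lemma vscal_S k x : vscal (INR (S k)) x = vadd x (vscal (INR k) x).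
Proof. apply functional_extensionality. intros i. unfold vscal, vadd. rewrite S_INR. ring. Qed.

Lemma mon_zero gs : mon gs vzero.
Proof.
  induction gs as [|g gs IH]; simpl; [reflexivity|].
  exists O, vzero. split; auto. rewrite vscal_0, vadd_zero_l. reflexivity.
Qed.

Lemma mon_vadd gs x y : mon gs x -> mon gs y -> mon gs (vadd x y).
Proof.
  revert x y. induction gs as [|g gs IH]; simpl; intros x y.
  - intros -> ->. apply vadd_zero_l.
  - intros (k & x' & Hx & ->) (m & y' & Hy & ->).
    exists (k + m)%nat, (vadd x' y'). split; auto.
    apply functional_extensionality. intros i. unfold vadd, vscal. rewrite plus_INR. ring.
Qed.

Lemma mon_in gs g : In g gs -> mon gs g.
Proof.
  induction gs as [|g' gs IH]; simpl; [tauto|]. intros [->|Hg].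
  - exists 1%nat, vzero. split; [apply mon_zero|].
    rewrite vscal_S, vscal_0, !vadd_zero_r. reflexivity.
  - exists O, g. split; auto. rewrite vscal_0, vadd_zero_l. reflexivity.
Qed.

Section Submonoid.
Variable L : V -> Prop.
Hypothesis L0 : L vzero.
Hypothesis LD : forall x y, L x -> L y -> L (vadd x y).

Lemma multiple_in x k : L x -> L (vscal (INR k) x).
Proof.
  intros Hx. induction k; [rewrite vscal_0; auto|rewrite vscal_S; auto].
Qed.

Lemma mon_incl gs x : (forall g, In g gs -> L g) -> mon gs x -> L x.
Proof.
  revert x. induction gs as [|g gs IH]; simpl; intros x Hg.
  - intros ->. exact L0.
  - intros (k & y & Hy & ->). apply LD; auto. apply multiple_in; auto.
Qed.
End Submonoid.

Lemma exp_INR_mul k a : exp (INR k * a) = exp a ^ k.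
Proof.
  induction k as [|k IH].
  - simpl. rewrite Rmult_0_l. apply exp_0.
  - rewrite S_INR, Rmult_plus_distr_r, exp_plus, IH, Rmult_1_l. simpl. ring.
Qed.

Lemma exp_le x y : x <= y -> exp x <= exp y.
Proof. intros [H| ->]; [left; apply exp_increasing, H|right; reflexivity]. Qed.

Lemma Rsum_geometric q n : 0 <= q < 1 ->
  Rsum_list (fun k => q ^ k) (seq 0 n) <= / (1 - q).
Proof.
  intros Hq.
  assert (E : Rsum_list (fun k => q ^ k) (seq 0 n) = (1 - q ^ n) * / (1 - q)).
  { induction n as [|n IH]; [simpl; ring|].
    rewrite seq_S, Rsum_app, IH. simpl. field. lra. }
  rewrite E. pose proof (pow_le q n ltac:(lra)).
  assert (0 < / (1 - q)) by (apply Rinv_0_lt_compat; lra). nra.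
Qed.

Lemma Rsum_flat_map {I J : Type} (f : J -> R) (g : I -> list J) l :
  Rsum_list f (flat_map g l) = Rsum_list (fun i => Rsum_list f (g i)) l.
Proof. induction l as [|i l IH]; simpl; [reflexivity|]. rewrite Rsum_app, IH. reflexivity. Qed.

(** Combinations with all exponents below [n]. Relations between generators make a vector appear
    repeatedly, which is harmless for upper bounds. *)
Fixpoint box (n : nat) (gs : list V) : list V :=
  match gs with
  | [] => [vzero]
  | g :: gs => flat_map (fun k => map (vadd (vscal (INR k) g)) (box n gs)) (seq 0 n)
  end.

Lemma mon_box gs x : mon gs x -> exists n0, forall n, (n0 <= n)%nat -> In x (box n gs).
Proof.
  revert x. induction gs as [|g gs IH]; simpl; intros x.
  - intros ->. exists O. auto.
  - intros (k & y & Hy & ->). destruct (IH y Hy) as [n0 Hn0].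
    exists (n0 + S k)%nat. intros n Hn. apply in_flat_map. exists k. split.
    + apply in_seq. lia.
    + apply in_map, Hn0. lia.
Qed.

Section MonoidEstimates.
Variable r : nat.

(** The exponential is multiplicative, so the sum factors into partial geometric series with ratios
    [exp (- h * vsum r g) < 1], bounded independently of [n]. *)
Lemma box_sum_bounded h gs : 0 < h -> (forall g, In g gs -> 0 < vsum r g) ->
  exists K, forall n, Rsum_list (fun x => exp (- h * vsum r x)) (box n gs) <= K.
Proof.
  intros Hh. induction gs as [|g gs IH]; intros Hg.
  - exists (exp (- h * vsum r vzero) + 0). intros n. simpl. lra.
  - destruct IH as [K HK]; [intros; apply Hg; right; auto|].
    pose proof (Hg g (or_introl eq_refl)) as Hg0.
    set (q := exp (- h * vsum r g)).
    assert (Hq : 0 <= q < 1).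
    { split; [left; apply exp_pos|]. unfold q. rewrite <- exp_0. apply exp_increasing. nra. }
    assert (Hqi : 0 < / (1 - q)) by (apply Rinv_0_lt_compat; lra).
    exists (/ (1 - q) * K). intros n. simpl. rewrite Rsum_flat_map.
    apply Rle_trans with (Rsum_list (fun k =>
      Rsum_list (fun x => exp (- h * vsum r x)) (box n gs) * q ^ k) (seq 0 n)).
    + apply Rsum_le. intros k _. rewrite Rsum_map, Rmult_comm, <- Rsum_scal.
      apply Rsum_le. intros x _. unfold q. rewrite <- exp_INR_mul, <- exp_plus.
      right. f_equal. unfold vsum. rewrite rdot_vadd_l, rdot_vscal_l. ring.
    + rewrite Rsum_scal, Rmult_comm.
      assert (0 <= Rsum_list (fun x => exp (- h * vsum r x)) (box n gs)).
      { apply Rsum_ge0. intros; left; apply exp_pos. }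
      apply Rmult_le_compat; auto.
      * apply Rsum_ge0. intros. apply pow_le. lra.
      * apply Rsum_geometric. assumption.
Qed.

(** Every finite list of monoid elements lies in some box, and the bound for boxes is uniform. *)
Lemma mon_sum_bounded h gs : 0 < h -> (forall g, In g gs -> 0 < vsum r g) ->
  exists K, 0 <= K /\ forall l, NoDup l -> (forall x, In x l -> mon gs x) ->
    Rsum_list (fun x => exp (- h * vsum r x)) l <= K.
Proof.
  intros Hh Hg. destruct (box_sum_bounded h gs Hh Hg) as [K HK]. exists K. split.
  - eapply Rle_trans; [|apply (HK O)]. apply Rsum_ge0. intros; left; apply exp_pos.
  - intros l Hl Hm.
    assert (Hn : exists n0, forall n, (n0 <= n)%nat -> incl l (box n gs)).
    { clear Hl. induction l as [|x l IH]; [exists O; intros n _ y []|].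
      destruct IH as [n1 H1]; [intros; apply Hm; right; auto|].
      destruct (mon_box gs x (Hm x (or_introl eq_refl))) as [n2 H2].
      exists (n1 + n2)%nat. intros n Hn y [<-|Hy]; [apply H2|apply H1; auto]; lia. }
    destruct Hn as [n0 Hn0]. eapply Rle_trans; [|apply (HK n0)].
    apply Rsum_incl; auto. intros; left; apply exp_pos.
Qed.

(** * Subexponential growth of an admissible weight *)

Section Weight.
Variables (L : V -> Prop) (w : V -> R).
Hypothesis L0 : L vzero.
Hypothesis LD : forall x y, L x -> L y -> L (vadd x y).
Hypothesis Hw : admissible L w.

(** The root condition gives [w (k g) < exp (k c)] for all large [k]; the constant absorbs the
    finitely many earlier values. *)
Lemma weight_multiple_growth g c : L g -> 0 < c ->
  exists D, 0 <= D /\ forall k, w (vscal (INR k) g) <= D * exp (INR k * c).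
Proof.
  intros Hg Hc. destruct Hw as ((Hpos & _) & _ & Hlim).
  assert (Hposk : forall k, 0 < w (vscal (INR k) g)).
  { intros k. apply Hpos, multiple_in; auto. }
  assert (Hexp : 1 < exp c) by (rewrite <- exp_0; apply exp_increasing, Hc).
  destruct (Hlim g Hg (exp c - 1) ltac:(lra)) as [k0 Hk0].
  set (A := Rsum_list (fun k => w (vscal (INR k) g)) (seq 0 (S k0))).
  assert (HA : forall k, (k <= k0)%nat -> w (vscal (INR k) g) <= A).
  { intros k Hk. replace (w (vscal (INR k) g))
      with (Rsum_list (fun k => w (vscal (INR k) g)) [k]) by (simpl; ring).
    apply Rsum_incl.
    - intros; left; auto.
    - repeat constructor. intros [].
    - intros j [<-|[]]. apply in_seq. lia. }
  assert (HA0 : 0 <= A) by (apply Rsum_ge0; intros; left; auto).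
  (* [A] covers [k <= k0], including [k = 0] where the root carries no information; [1] covers the
     rest. *)
  exists (A + 1). split; [lra|]. intros k.
  destruct (Nat.le_gt_cases k k0) as [Hk|Hk].
  - assert (1 <= exp (INR k * c)).
    { rewrite <- exp_0. apply exp_le. pose proof (pos_INR k). nra. }
    specialize (HA k Hk). nra.
  - specialize (Hk0 k ltac:(lia)). unfold Rdist in Hk0. apply Rabs_def2 in Hk0.
    destruct Hk0 as [Hk0 _].
    assert (HkR : 0 < INR k) by (apply lt_0_INR; lia).
    assert (Hlt : Rpower (w (vscal (INR k) g)) (/ INR k) < exp c) by lra.
    unfold Rpower in Hlt. apply exp_lt_inv in Hlt.
    assert (Hln : ln (w (vscal (INR k) g)) < INR k * c).
    { apply (Rmult_lt_reg_l (/ INR k)); [apply Rinv_0_lt_compat; auto|].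
      rewrite <- Rmult_assoc, Rinv_l, Rmult_1_l by lra. exact Hlt. }
    apply exp_increasing in Hln. rewrite exp_ln in Hln by auto.
    pose proof (exp_pos (INR k * c)). nra.
Qed.

(** Submultiplicativity splits off one generator at a time, each growing at an arbitrarily small
    exponential rate; finitely many constants multiply up to [D]. *)
Lemma weight_growth eta gs : 0 < eta -> (forall g, In g gs -> L g /\ 0 < vsum r g) ->
  exists D, 0 <= D /\ forall x, mon gs x -> w x <= D * exp (eta * vsum r x).
Proof.
  intros He. induction gs as [|g gs IH]; intros Hg.
  - exists 1. split; [lra|]. simpl. intros x ->.
    destruct Hw as ((_ & H0 & _) & _). unfold vsum.
    rewrite H0, rdot_vzero_l, Rmult_0_r, exp_0. lra.
  - destruct IH as (D & HD & HDx); [intros; apply Hg; right; auto|].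
    destruct (Hg g (or_introl eq_refl)) as [HgL Hg0].
    destruct (weight_multiple_growth g (eta * vsum r g) HgL ltac:(nra)) as (D' & HD' & HDk).
    exists (D' * D). split; [nra|]. intros x (k & y & Hy & ->).
    destruct Hw as ((Hpos & _ & Hsub) & _).
    assert (HyL : L y).
    { apply (mon_incl L L0 LD gs); auto. intros; apply Hg; right; auto. }
    assert (HkL : L (vscal (INR k) g)) by (apply multiple_in; auto).
    eapply Rle_trans; [apply Hsub; auto|].
    unfold vsum. rewrite rdot_vadd_l, rdot_vscal_l. fold (vsum r g) (vsum r y).
    replace (eta * (INR k * vsum r g + vsum r y))
      with (INR k * (eta * vsum r g) + eta * vsum r y) by ring.
    rewrite exp_plus.
    replace (D' * D * (exp (INR k * (eta * vsum r g)) * exp (eta * vsum r y)))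
      with ((D' * exp (INR k * (eta * vsum r g))) * (D * exp (eta * vsum r y))) by ring.
    pose proof (Hpos _ HyL). pose proof (Hpos _ HkL).
    apply Rmult_le_compat; auto; lra.
Qed.
End Weight.
End MonoidEstimates.

(** * Inverting a finite sum *)

Section FiniteInversion.
Variables (r : nat) (gs : list V) (p : Poly).
Hypothesis gs_pos : forall g, In g gs -> 0 < vsum r g.
Hypothesis M_ge0 : forall x, mon gs x -> forall i, (i < r)%nat -> 0 <= x i.
Hypothesis M_vanish : forall x, mon gs x -> vanishing_from r x.
Hypothesis p_supp : supp (mon gs) p.

Let M := mon gs.
Let one : V -> R := fun _ => 1.
Let M0 : M vzero := mon_zero gs.
Let MD : forall x y, M x -> M y -> M (vadd x y) := mon_vadd gs.

Let one_pos : forall x, M x -> 0 < one x.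
Proof. intros; unfold one; lra. Qed.

Let one_zero : one vzero = 1 := eq_refl.

Let one_sub : forall x y, M x -> M y -> one (vadd x y) <= one x * one y.
Proof. intros; unfold one; lra. Qed.

Let M_vsum x : M x -> 0 <= vsum r x.
Proof. intros Hx. apply vsum_ge0, M_ge0, Hx. Qed.

(** An error of [/ 2] suffices, because Neumann sums improve it to any precision. Invertibility is
    thus expressed inside finite sums. *)
Definition near_invertible (q : Poly) : Prop :=
  exists b, supp M b /\ nle M one (psub (pmul q b) pone) (/ 2).

Definition wave_lower_bound (d : R) (q : Poly) : Prop :=
  forall t, d <= Cnorm (ev (wave r t) q).

Let wave_unit t : forall x, M x -> Cnorm (wave r t x) <= 1 * one x.
Proof. intros x _. rewrite Cnorm_wave. unfold one. lra. Qed.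

(** On every wave the value of [q ^ N Q] is within [1] of [1], so it has modulus at most [2];
    dividing by [d ^ N] bounds the values of [Q], and [coef_le_sup] passes this to its
    coefficients. *)
Lemma inverse_coef_bound q d N Q : 0 < d -> wave_lower_bound d q -> supp M Q ->
  nle M one (psub (pmul (ppow q N) Q) pone) 1 ->
  forall x, M x -> Cnorm (coef x Q) <= 2 / d ^ N.
Proof.
  intros Hd Hlb HQ Herr x Hx.
  assert (HdN : 0 < d ^ N) by (apply pow_lt; auto).
  apply (coef_le_sup r Q).
  - unfold supp in *. rewrite Forall_forall in *. intros u Hu. apply M_vanish, HQ, Hu.
  - intros t. pose proof (wave_character r t) as Hch.
    pose proof (Herr (wave r t) 1 ltac:(lra) (wave_unit t)) as H.
    rewrite ev_padd, ev_popp, ev_pone, ev_char_pmul in H by assumption.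
    rewrite (proj1 Hch) in H.
    pose proof (Cnorm_sub_ge (Cmul (ev (wave r t) (ppow q N)) (ev (wave r t) Q)) C1) as H1.
    rewrite Cnorm_C1, Cnorm_mul, ev_char_ppow_norm in H1 by assumption.
    pose proof (pow_incr d (Cnorm (ev (wave r t) q)) N (conj (Rlt_le _ _ Hd) (Hlb t))) as H2.
    pose proof (Cnorm_ge0 (ev (wave r t) Q)) as H3.
    apply (Rmult_le_reg_l (d ^ N)); auto.
    replace (d ^ N * (2 / d ^ N)) with 2 by (field; lra).
    apply Rle_trans with (Cnorm (ev (wave r t) q) ^ N * Cnorm (ev (wave r t) Q)); [|lra].
    apply Rmult_le_compat_r; auto.
  - apply M_vanish, Hx.
Qed.

(** Passing from sup bounds on coefficients to [l^1] bounds costs a small extra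
    damping [h], because [M] is finitely generated. *)
Lemma damped_inverse_pow q d h v D K : 0 < d -> wave_lower_bound d q -> supp M q ->
  near_invertible q -> 0 <= D ->
  (forall x, M x -> exp (- h * vsum r x) * v x <= D) ->
  (forall l, NoDup l -> (forall x, In x l -> M x) ->
     Rsum_list (fun x => exp (- h * vsum r x) * v x) l <= K) ->
  forall N eps, 0 < eps -> exists Q, supp M Q /\
    nle M v (psub (pmul (ppow (tw r h q) N) Q) pone) eps /\
    nle M v Q (2 / d ^ N * K).
Proof.
  intros Hd Hlb Hq (b & Hb & Hqb) HD HvD HvK N eps Heps.
  (* Error at most [1] is needed for the coefficient bound; the second term of the minimum
     compensates the factor [D] that the twist costs. *)
  destruct (approx_inverse_pow M one M0 MD one_pos one_zero one_sub q b Hq Hb Hqb N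
    (Rmin 1 (eps / (D + 1)))) as (Q & HQ & Herr).
  { apply Rmin_glb_lt; [lra|]. apply Rdiv_lt_0_compat; lra. }
  assert (H1 : nle M one (psub (pmul (ppow q N) Q) pone) 1)
    by (eapply nle_mono; [apply Rmin_l|exact Herr]).
  pose proof (pow_lt d N Hd) as HdN.
  assert (H2d : 0 <= 2 / d ^ N) by (apply Rlt_le, Rdiv_lt_0_compat; lra).
  exists (tw r h Q). split; [apply supp_tw; auto|]. split.
  - assert (E : peq (psub (pmul (ppow (tw r h q) N) (tw r h Q)) pone)
      (tw r h (psub (pmul (ppow q N) Q) pone))).
    { rewrite tw_padd, tw_popp, tw_pone, tw_pmul, tw_ppow. reflexivity. }
    rewrite E. apply (nle_mono _ _ _ (D * Rmin 1 (eps / (D + 1)))).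
    + apply Rle_trans with (D * (eps / (D + 1))).
      * apply Rmult_le_compat_l; [auto|apply Rmin_r].
      * apply (Rmult_le_reg_r (D + 1)); [lra|].
        replace (D * (eps / (D + 1)) * (D + 1)) with (D * eps) by (field; lra). nra.
    + apply (nle_tw r M one v h _ _ D); auto. intros x Hx. unfold one.
      rewrite Rmult_1_r. auto.
  - replace (2 / d ^ N * K) with (1 * (2 / d ^ N * K)) by ring.
    (* Viewed from the damped weight, the twist costs only the constant [1]. *)
    apply (nle_tw r M (fun x => exp (- h * vsum r x) * v x)); [lra|intros; lra|].
    apply nle_of_coef; auto. apply (inverse_coef_bound q d N Q); auto.
Qed.

(** A perturbation of half the lower bound, against an inverse power of size [2 / d ^ N * c], leaves
    a factor [(/ 2) ^ N]; the constant [c] is therefore irrelevant for large [N]. *)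
Lemma pow_decay c d N : 0 < d -> (d / 2) ^ N * (2 / d ^ N * c) = 2 * c * (/ 2) ^ N.
Proof.
  intros Hd. pose proof (pow_lt d N Hd). unfold Rdiv. rewrite Rpow_mult_distr. field. lra.
Qed.

Lemma exists_pow_half_le c eps : 0 <= c -> 0 < eps -> exists N, c * (/ 2) ^ N <= eps.
Proof.
  intros Hc He.
  destruct (pow_lt_1_zero (/ 2) ltac:(rewrite Rabs_pos_eq; lra) (eps / (c + 1))) as [N HN].
  { apply Rdiv_lt_0_compat; lra. }
  exists N. specialize (HN N (le_n N)). pose proof (pow_le (/ 2) N ltac:(lra)) as Hp.
  rewrite Rabs_pos_eq in HN by auto.
  apply (Rmult_lt_compat_r (c + 1)) in HN; [|lra].
  replace (eps / (c + 1) * (c + 1)) with eps in HN by (field; lra). nra.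
Qed.

(** Damping moves from [tau] up to [tau + h], where powers have controlled inverses; the
    perturbation then goes down by [2 * h], a net descent of [h]. *)
Lemma near_invertible_step tau h d : 0 < h -> 0 < d ->
  wave_lower_bound d (tw r tau p) -> near_invertible (tw r tau p) ->
  nle M one (psub (tw r (tau - h) p) (tw r (tau + h) p)) (d / 2) ->
  near_invertible (tw r (tau - h) p).
Proof.
  intros Hh Hd Hlb Hinv Hdiff.
  destruct (mon_sum_bounded r h gs Hh gs_pos) as (K & HK0 & HK).
  (* The perturbation term becomes at most [/ 4]; together with the error [/ 4] of [Q] this makes
     [/ 2]. *)
  destruct (exists_pow_half_le (2 * K) (/ 4)) as [N HN]; [lra|lra|].
  destruct (damped_inverse_pow (tw r tau p) d h one 1 K Hd Hlb) with (N := N) (eps := / 4)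
    as (Q & HQ & Herr & HQn); auto; try lra.
  - apply supp_tw, p_supp.
  - intros x Hx. unfold one. rewrite Rmult_1_r, <- exp_0. apply exp_le.
    pose proof (M_vsum x Hx). nra.
  - intros l Hl HlM. eapply Rle_trans; [|apply (HK l Hl HlM)].
    apply Rsum_le. intros; unfold one; lra.
  - set (rr := psub (tw r (tau - h) p) (tw r (tau + h) p)) in *.
    assert (E : peq (tw r (tau - h) p) (padd (tw r h (tw r tau p)) rr)).
    { rewrite tw_tw, (Rplus_comm h tau). unfold rr. ring. }
    exists (pmul (geom (tw r h (tw r tau p)) rr N) Q). split.
    + apply supp_pmul; auto. apply supp_geom; auto.
      * apply supp_tw, supp_tw, p_supp.
      * apply supp_padd; [|apply supp_popp]; apply supp_tw, p_supp.
    + rewrite E. apply (nle_mono _ _ _ (/ 4 + (d / 2) ^ N * (2 / d ^ N * K))).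
      * rewrite pow_decay by auto. lra.
      * apply nle_perturb; auto.
Qed.

(** With [l = vsum r x], a term changes by [exp (- (tau - h) l) (1 - exp (- 2 h l)) <= exp l * 2 h
    l]. The allowance down to [- 1] lets the descent cross zero with the same [C]. *)
Lemma tw_diff_bound : exists C, 0 <= C /\ forall tau h, 0 < h -> -1 <= tau - h ->
  nle M one (psub (tw r (tau - h) p) (tw r (tau + h) p)) (C * h).
Proof.
  exists (Rsum_list (fun t => Cnorm (fst t) * (2 * vsum r (snd t) * exp (vsum r (snd t)))) p).
  assert (Hv : forall t, In t p -> 0 <= vsum r (snd t)).
  { intros t Ht. apply M_vsum. pose proof p_supp as Hs. unfold supp in Hs.
    rewrite Forall_forall in Hs. apply Hs, Ht. }
  split.
  - apply Rsum_ge0. intros t Ht. pose proof (Cnorm_ge0 (fst t)). pose proof (Hv t Ht).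
    pose proof (exp_pos (vsum r (snd t))). apply Rmult_le_pos; nra.
  - intros tau h Hh Htau phi c Hc Hphi.
    rewrite ev_padd, ev_popp, !ev_tw.
    replace (Csub (ev (fun x => Cmul (RtoC (exp (- (tau - h) * vsum r x))) (phi x)) p)
                  (ev (fun x => Cmul (RtoC (exp (- (tau + h) * vsum r x))) (phi x)) p))
      with (ev (fun x => Cmul (RtoC (exp (- (tau - h) * vsum r x)
                                     - exp (- (tau + h) * vsum r x))) (phi x)) p).
    2: { transitivity (ev (fun x => Cadd
           (Cmul (RtoC (exp (- (tau - h) * vsum r x))) (phi x))
           (Cmul (Copp C1) (Cmul (RtoC (exp (- (tau + h) * vsum r x))) (phi x)))) p).
         - apply ev_ext. intros t _. unfold Cadd, Cmul, RtoC, Copp, C1; simpl. f_equal; ring.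
         - rewrite ev_add, ev_scal. ring. }
    replace (c * (Rsum_list (fun t => Cnorm (fst t) *
        (2 * vsum r (snd t) * exp (vsum r (snd t)))) p * h))
      with ((c * h) * Rsum_list (fun t => Cnorm (fst t) *
        (2 * vsum r (snd t) * exp (vsum r (snd t)))) p) by ring.
    rewrite <- Rsum_scal. apply Cnorm_sum. intros t Ht.
    rewrite !Cnorm_mul, Cnorm_RtoC. pose proof (Hv t Ht) as Hl. set (l := vsum r (snd t)) in *.
    assert (Hx : M (snd t)).
    { pose proof p_supp as Hs. unfold supp in Hs. rewrite Forall_forall in Hs. apply Hs, Ht. }
    specialize (Hphi _ Hx). unfold one in Hphi.
    pose proof (Cnorm_ge0 (phi (snd t))). pose proof (Cnorm_ge0 (fst t)).
    assert (H1 : exp (- (tau - h) * l) <= exp l) by (apply exp_le; nra).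
    assert (H2 : exp (- (tau + h) * l) = exp (- (tau - h) * l) * exp (- (2 * h * l)))
      by (rewrite <- exp_plus; f_equal; ring).
    pose proof (exp_ineq1_le (- (2 * h * l))) as H3.
    assert (H4 : exp (- (2 * h * l)) <= 1) by (rewrite <- exp_0; apply exp_le; nra).
    pose proof (exp_pos (- (tau - h) * l)) as H5.
    assert (H6 : 0 <= h * l) by nra.
    rewrite Rabs_pos_eq by nra.
    apply Rle_trans with (Cnorm (fst t) * ((2 * h * l * exp l) * c)); [|right; ring].
    apply Rmult_le_compat_l; auto. apply Rmult_le_compat; auto; try nra.
Qed.

(** Terms at nonzero vectors have positive [vsum] and die out, uniformly over bounded [phi]; the
    terms at [vzero] are unaffected and add up to [c0]. *)
Lemma tw_limit : exists c0, forall eps, 0 < eps -> exists T, forall tau, T <= tau ->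
  forall phi c, 0 <= c -> (forall x, M x -> Cnorm (phi x) <= c) ->
    Cnorm (Csub (ev phi (tw r tau p)) (Cmul c0 (phi vzero))) <= c * eps.
Proof.
  pose proof p_supp as Hs. clear p_supp. induction p as [|[a x] q IH].
  - exists C0. intros eps He. exists 0. intros tau _ phi c Hc _.
    change (ev phi (tw r tau [])) with C0.
    replace (Csub C0 (Cmul C0 (phi vzero))) with C0 by ring. rewrite Cnorm_C0. nra.
  - inversion Hs as [|? ? Hx Hq]; subst. simpl in Hx. destruct (IH Hq) as [c0 Hc0].
    assert (Hev : forall phi tau, ev phi (tw r tau ((a, x) :: q)) =
      Cadd (Cmul (Cmul a (RtoC (exp (- tau * vsum r x)))) (phi x)) (ev phi (tw r tau q)))
      by reflexivity.
    destruct (excluded_middle_informative (x = vzero)) as [->|Hn].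
    + exists (Cadd a c0). intros eps He. destruct (Hc0 eps He) as [T HT].
      exists T. intros tau Htau phi c Hc Hphi. rewrite Hev.
      unfold vsum at 1. rewrite rdot_vzero_l, Rmult_0_r, exp_0, RtoC_1.
      match goal with |- Cnorm ?z <= _ =>
        replace z with (Csub (ev phi (tw r tau q)) (Cmul c0 (phi vzero))) by ring end.
      auto.
    + exists c0. intros eps He. destruct (Hc0 (eps / 2) ltac:(lra)) as [T HT].
      assert (Hl : 0 < vsum r x).
      { apply vsum_gt0; [apply M_ge0|apply M_vanish|]; auto. }
      pose proof (Cnorm_ge0 a) as Ha.
      (* Once the exponential is below [/ y] this term costs at most [eps / 2]; the [+ 1] keeps [y]
         positive when the coefficient vanishes. *)
      set (y := 2 * (Cnorm a + 1) / eps).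
      assert (Hy : 0 < y) by (apply Rdiv_lt_0_compat; lra).
      exists (Rmax T (y / vsum r x)). intros tau Htau phi c Hc Hphi. rewrite Hev.
      pose proof (Rmax_l T (y / vsum r x)). pose proof (Rmax_r T (y / vsum r x)).
      specialize (HT tau ltac:(lra) phi c Hc Hphi).
      match goal with |- Cnorm ?z <= _ => replace z with
        (Cadd (Cmul (Cmul a (RtoC (exp (- tau * vsum r x)))) (phi x))
              (Csub (ev phi (tw r tau q)) (Cmul c0 (phi vzero)))) by ring end.
      eapply Rle_trans; [apply Cnorm_add|].
      rewrite !Cnorm_mul, Cnorm_RtoC, Rabs_pos_eq by (left; apply exp_pos).
      specialize (Hphi x Hx). pose proof (Cnorm_ge0 (phi x)).
      assert (Hyt : y <= tau * vsum r x).
      { apply (Rmult_le_reg_r (/ vsum r x)); [apply Rinv_0_lt_compat; auto|].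
        rewrite Rmult_assoc, Rinv_r by lra. unfold Rdiv in *. lra. }
      assert (He1 : exp (- tau * vsum r x) <= / y).
      { replace (- tau * vsum r x) with (- (tau * vsum r x)) by ring. rewrite exp_Ropp.
        apply Rinv_le_contravar; auto.
        pose proof (exp_ineq1_le (tau * vsum r x)). lra. }
      assert (He2 : Cnorm a * exp (- tau * vsum r x) <= eps / 2).
      { apply Rle_trans with ((Cnorm a + 1) * / y).
        - apply Rmult_le_compat; auto; [left; apply exp_pos|lra].
        - right. unfold y. field. lra. }
      pose proof (exp_pos (- tau * vsum r x)).
      assert (Cnorm a * exp (- tau * vsum r x) * Cnorm (phi x) <= eps / 2 * c).
      { apply Rmult_le_compat; auto. nra. }
      lra.
Qed.

(** * Descent across the imaginary line *)

Section LowerBound.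
Variable d : R.
Hypothesis d_pos : 0 < d.
Hypothesis p_lower : forall tau, 0 < tau -> wave_lower_bound d (tw r tau p).

(** The constant term inherits a lower bound, so its inverse is an approximate inverse as soon as
    the other terms have norm at most half of it. *)
Lemma near_invertible_large : exists T, forall tau, T <= tau -> near_invertible (tw r tau p).
Proof.
  destruct tw_limit as [c0 Hc0].
  (* At a large positive [tau] the trivial wave has value at least [d] in modulus and within [d / 2]
     of [c0]. *)
  assert (H0 : 0 < Cnorm c0).
  { destruct (Hc0 (d / 2) ltac:(lra)) as [T HT].
    specialize (HT (Rmax T 1) (Rmax_l _ _) (wave r vzero) 1 ltac:(lra)).
    specialize (p_lower (Rmax T 1) ltac:(pose proof (Rmax_r T 1); lra) vzero).
    rewrite (proj1 (wave_character r vzero)) in HT.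
    assert (HT' := HT ltac:(intros; rewrite Cnorm_wave; lra)).
    match type of HT' with Cnorm (Csub ?z ?u) <= _ => pose proof (Cnorm_sub_ge z u) as H end.
    rewrite Cnorm_mul, Cnorm_C1 in H. lra. }
  assert (Hn : c0 <> C0) by (intros E; rewrite E, Cnorm_C0 in H0; lra).
  destruct (Hc0 (Cnorm c0 / 2) ltac:(lra)) as [T HT]. exists T. intros tau Htau.
  exists [(Cinv c0, vzero)]. split; [repeat constructor; apply M0|].
  intros phi c Hc Hphi. specialize (HT tau Htau phi c Hc).
  rewrite ev_padd, ev_popp, ev_pone, ev_pmul.
  rewrite (ev_ext _ (fun x => Cmul (Cinv c0) (phi x))).
  2: { intros t _. unfold ev; simpl. rewrite vadd_zero_r. ring. }
  rewrite ev_scal.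
  replace (Csub (Cmul (Cinv c0) (ev phi (tw r tau p))) (phi vzero))
    with (Cmul (Cinv c0) (Csub (ev phi (tw r tau p)) (Cmul c0 (phi vzero)))).
  2: { transitivity (Csub (Cmul (Cinv c0) (ev phi (tw r tau p)))
         (Cmul (Cmul (Cinv c0) c0) (phi vzero))); [ring|].
       rewrite Cmul_inv_l by assumption. ring. }
  assert (Hi : Cnorm (Cinv c0) * Cnorm c0 = 1)
    by (rewrite <- Cnorm_mul, Cmul_inv_l, Cnorm_C1; auto).
  rewrite Cnorm_mul. pose proof (Cnorm_ge0 (Cinv c0)).
  apply Rle_trans with (Cnorm (Cinv c0) * (c * (Cnorm c0 / 2))).
  - apply Rmult_le_compat_l; auto. apply HT. intros x Hx. specialize (Hphi x Hx).
    unfold one in Hphi. lra.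
  - replace (Cnorm (Cinv c0) * (c * (Cnorm c0 / 2)))
      with (c * (Cnorm (Cinv c0) * Cnorm c0) / 2) by field. rewrite Hi. lra.
Qed.

(** The step size [h] does not depend on [tau], so the descent from large [tau] along
    [tau = (k + 1/2) h] crosses the line [tau = 0]. *)
Lemma near_invertible_past_zero : exists eta, 0 < eta /\
  near_invertible (tw r (- eta) p) /\ wave_lower_bound (d / 2) (tw r (- eta) p).
Proof.
  destruct tw_diff_bound as (C & HC & Hdiff).
  destruct near_invertible_large as [T HT].
  (* [h <= 1] keeps the descent above [- 1], and [C * h <= d / 2] makes each step an admissible
     perturbation. *)
  set (h := Rmin 1 (d / (2 * (C + 1)))).
  assert (Hd2 : 0 < d / (2 * (C + 1))) by (apply Rdiv_lt_0_compat; lra).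
  assert (Hh : 0 < h) by (apply Rmin_glb_lt; lra).
  assert (Hh1 : h <= 1) by apply Rmin_l.
  assert (HCh : C * h <= d / 2).
  { apply Rle_trans with ((C + 1) * (d / (2 * (C + 1)))).
    - apply Rmult_le_compat; try lra. apply Rmin_r.
    - right. field. lra. }
  exists (h / 2). split; [lra|]. split.
  - assert (H : forall k, near_invertible (tw r ((INR k + / 2) * h) p) ->
      near_invertible (tw r (- (h / 2)) p)).
    { induction k as [|k IH]; intros Hk.
      - replace (- (h / 2)) with ((INR 0 + / 2) * h - h) by (simpl; field).
        apply (near_invertible_step _ h d); auto.
        + apply p_lower. simpl. lra.
        + eapply nle_mono; [exact HCh|]. apply Hdiff; [auto|simpl; lra].
      - apply IH. replace ((INR k + / 2) * h) with ((INR (S k) + / 2) * h - h)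
          by (rewrite S_INR; ring).
        assert (0 <= INR k * h) by (pose proof (pos_INR k); nra).
        apply (near_invertible_step _ h d); auto.
        + apply p_lower. rewrite S_INR. lra.
        + eapply nle_mono; [exact HCh|]. apply Hdiff; [auto|rewrite S_INR; lra]. }
    destruct (INR_unbounded (T / h)) as [k Hk]. apply (H k), HT.
    apply (Rmult_gt_compat_r h) in Hk; [|lra].
    replace (T / h * h) with T in Hk by (field; lra). lra.
  (* Values at [- h / 2] are compared with those at [h / 2], where the bound [d] holds; the
     difference is at most [C * (h / 2)]. *)
  - intros t. pose proof (p_lower (h / 2) ltac:(lra) t) as H1.
    pose proof (Hdiff 0 (h / 2) ltac:(lra) ltac:(lra) (wave r t) 1 ltac:(lra) (wave_unit t)) as H2.
    rewrite ev_padd, ev_popp, Cnorm_sub_sym in H2.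
    replace (0 - h / 2) with (- (h / 2)) in H2 by ring.
    rewrite Rplus_0_l in H2.
    pose proof (Cnorm_sub_ge (ev (wave r t) (tw r (h / 2) p))
      (ev (wave r t) (tw r (- (h / 2)) p))). lra.
Qed.

(** Starting at [- eta], a damping by [eta] leads back to [p] itself. Half of that margin absorbs
    the growth of [w], the other half makes the sum over the monoid finite. *)
Lemma weighted_inverse_pow (L : V -> Prop) (w : V -> R) :
  L vzero -> (forall x y, L x -> L y -> L (vadd x y)) -> admissible L w ->
  (forall g, In g gs -> L g) ->
  exists D, 0 <= D /\ forall N eps, 0 < eps -> exists Q, supp L Q /\
    nle L w (psub (pmul (ppow p N) Q) pone) eps /\
    nle L w Q (2 / (d / 2) ^ N * D).
Proof.
  intros L0 LD Hw HgL.
  assert (HML : forall x, M x -> L x) by (intros x; apply mon_incl; auto).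
  assert (Hmono : forall q B, nle M w q B -> nle L w q B).
  { intros q B Hq phi c Hc Hphi. apply Hq; auto. }
  destruct near_invertible_past_zero as (eta & Heta & Hinv & Hlb).
  destruct (weight_growth r L w L0 LD Hw (eta / 2) gs) as (D1 & HD1 & Hgrow); [lra|auto|].
  destruct (mon_sum_bounded r (eta / 2) gs) as (K & HK0 & HK); [lra|auto|].
  assert (Hwx : forall x, M x ->
    exp (- eta * vsum r x) * w x <= D1 * exp (- (eta / 2) * vsum r x)).
  { intros x Hx. replace (- (eta / 2) * vsum r x)
      with (- eta * vsum r x + eta / 2 * vsum r x) by field.
    rewrite exp_plus. pose proof (exp_pos (- eta * vsum r x)). specialize (Hgrow x Hx). nra. }
  exists (D1 * K). split; [nra|]. intros N eps Heps.
  destruct (damped_inverse_pow (tw r (- eta) p) (d / 2) eta w D1 (D1 * K))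
    with (N := N) (eps := eps) as (Q & HQ & Herr & HQn); auto; try lra.
  - apply supp_tw, p_supp.
  - intros x Hx. eapply Rle_trans; [apply Hwx, Hx|].
    assert (exp (- (eta / 2) * vsum r x) <= 1).
    { rewrite <- exp_0. apply exp_le. pose proof (M_vsum x Hx). nra. }
    nra.
  - intros l Hl HlM. eapply Rle_trans; [apply Rsum_le; intros; apply Hwx; auto|].
    rewrite Rsum_scal. apply Rmult_le_compat_l; auto.
  - exists Q. split; [|split; auto].
    + unfold supp in *. rewrite Forall_forall in *. auto.
    + apply Hmono. assert (E : peq (tw r eta (tw r (- eta) p)) p).
      { rewrite tw_tw. intros phi. rewrite ev_tw. apply ev_ext. intros t _.
        replace (- (eta + - eta) * vsum r (snd t)) with 0 by ring.
        rewrite exp_0, RtoC_1. ring. }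
      rewrite E in Herr. exact Herr.
Qed.
End LowerBound.
End FiniteInversion.

(** * Passing to the limit *)

(** A common error scale, linear in [c], so that errors add by adding constants; the successor
    avoids division by zero. *)
Definition hyp (c : R) (n : nat) : R := c / INR (S n).

Lemma hyp_mono c n m : 0 <= c -> (n <= m)%nat -> hyp c m <= hyp c n.
Proof.
  intros Hc Hn. unfold hyp, Rdiv. apply Rmult_le_compat_l; auto.
  apply Rinv_le_contravar; [apply lt_0_INR; lia|apply le_INR; lia].
Qed.

Lemma hyp_ge0 c n : 0 <= c -> 0 <= hyp c n.
Proof.
  intros Hc. unfold hyp, Rdiv. apply Rmult_le_pos; auto.
  left. apply Rinv_0_lt_compat, lt_0_INR. lia.
Qed.

Lemma hyp_small c eps : 0 <= c -> 0 < eps -> exists n0, forall n, (n0 <= n)%nat -> hyp c n < eps.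
Proof.
  intros Hc He. destruct (INR_unbounded (c / eps)) as [n0 Hn0]. exists n0. intros n Hn.
  apply Rle_lt_trans with (hyp c n0); [apply hyp_mono; auto|].
  unfold hyp. assert (0 < INR (S n0)) by (apply lt_0_INR; lia).
  apply (Rmult_lt_reg_r (INR (S n0))); auto.
  replace (c / INR (S n0) * INR (S n0)) with c by (field; lra).
  apply (Rmult_gt_compat_r eps) in Hn0; auto.
  replace (c / eps * eps) with c in Hn0 by (field; lra). rewrite S_INR. nra.
Qed.

Lemma pow_half_le_hyp n : (/ 2) ^ n <= hyp 1 n.
Proof.
  unfold hyp, Rdiv. rewrite Rmult_1_l, pow_inv. apply Rinv_le_contravar.
  - apply lt_0_INR. lia.
  - induction n as [|n IH]; [simpl; lra|]. rewrite S_INR.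
    change (2 ^ S n) with (2 * 2 ^ n). pose proof (pow_R1_Rle 2 n ltac:(lra)). lra.
Qed.

Lemma map_preimage {I J : Type} (f : I -> J) l :
  (forall y, In y l -> exists i, f i = y) -> exists l', map f l' = l.
Proof.
  induction l as [|y l IH]; intros H; [exists []; reflexivity|].
  destruct IH as [l' <-]; [intros; apply H; right; auto|].
  destruct (H y (or_introl eq_refl)) as [i <-]. exists (i :: l'). reflexivity.
Qed.

Lemma NoDup_map_injective {I J : Type} (f : I -> J) l :
  (forall x y, f x = f y -> x = y) -> NoDup l -> NoDup (map f l).
Proof. intros Hf. apply FinFun.Injective_map_NoDup. exact Hf. Qed.

Lemma sig_eq {T : Type} (P : T -> Prop) (x y : {t | P t}) :
  proj1_sig x = proj1_sig y -> x = y.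
Proof.
  destruct x as [x Hx], y as [y Hy]; simpl. intros E. subst y.
  f_equal. apply Classical_Prop.proof_irrelevance.
Qed.

Lemma Csum_filter (f : V -> Cx) P l : (forall x, In x l -> P x = false -> f x = C0) ->
  Csum_list f (filter P l) = Csum_list f l.
Proof.
  induction l as [|x l IH]; intros H; simpl; [reflexivity|].
  destruct (P x) eqn:E; simpl; rewrite IH by (intros; apply H; [right|]; auto); auto.
  rewrite (H x) by (simpl; auto). ring.
Qed.

Definition restrict (a : V -> Cx) (l : list V) : Poly := map (fun x => (a x, x)) l.

Lemma ev_restrict phi a l : ev phi (restrict a l) = Csum_list (fun x => Cmul (a x) (phi x)) l.
Proof. unfold ev, restrict. rewrite Csum_map. reflexivity. Qed.

Definition nodup_in (L : V -> Prop) (l : list V) : Prop :=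
  NoDup l /\ forall x, In x l -> L x.

Lemma in_Aw_bound L w a : in_Aw L w a ->
  exists A, forall l, nodup_in L l -> Rsum_list (fun x => Cnorm (a x) * w x) l <= A.
Proof.
  intros [A HA]. exists A. intros l [Hl HlL].
  destruct (map_preimage (@proj1_sig V L) l) as [l' <-].
  { intros y Hy. exists (exist _ y (HlL y Hy)). reflexivity. }
  rewrite Rsum_map. apply HA, (NoDup_map_inv (@proj1_sig V L)), Hl.
Qed.

Definition tails_below (L : V -> Prop) (w : V -> R) (a : V -> Cx) (l : list V) (e : R) : Prop :=
  forall l', nodup_in L l' -> (forall x, In x l' -> ~ In x l) ->
    Rsum_list (fun x => Cnorm (a x) * w x) l' <= e.

(** A finite list whose sum is within [1 / (n + 1)] of the supremum leaves at most that much for any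
    list disjoint from it. *)
Lemma truncations L w a : in_Aw L w a ->
  exists t : nat -> list V, forall n, nodup_in L (t n) /\ tails_below L w a (t n) (hyp 1 n).
Proof.
  intros Ha. destruct (in_Aw_bound L w a Ha) as [A HA].
  set (E := fun s => exists l, nodup_in L l /\ s = Rsum_list (fun x => Cnorm (a x) * w x) l).
  destruct (completeness E) as [s [Hub Hlub]].
  - exists A. intros y (l & Hl & ->). auto.
  - exists 0, []. split; [|reflexivity]. split; [constructor|intros x []].
  - assert (H : forall n, exists l, nodup_in L l /\ tails_below L w a l (hyp 1 n)).
    { intros n. assert (Hp : 0 < hyp 1 n).
      { unfold hyp, Rdiv. rewrite Rmult_1_l. apply Rinv_0_lt_compat, lt_0_INR. lia. }
      destruct (excluded_middle_informative (exists l, nodup_in L l /\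
        s - hyp 1 n < Rsum_list (fun x => Cnorm (a x) * w x) l)) as [(l & Hl & Hls)|Hno].
      - exists l. split; auto. intros l' Hl' Hd.
        assert (HE : E (Rsum_list (fun x => Cnorm (a x) * w x) (l ++ l'))).
        { exists (l ++ l'). split; auto. destruct Hl, Hl'. split.
          - apply NoDup_app; auto. intros x Hx Hx'. apply (Hd x); auto.
          - intros x Hx. apply in_app_iff in Hx. destruct Hx; auto. }
        apply Hub in HE. rewrite Rsum_app in HE. lra.
      - exfalso. assert (s <= s - hyp 1 n); [|lra]. apply Hlub. intros y (l & Hl & ->).
        apply Rnot_lt_le. intros Hlt. apply Hno. eauto. }
    exists (fun n => proj1_sig (constructive_indefinite_description _ (H n))).
    intros n. exact (proj2_sig (constructive_indefinite_description _ (H n))).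
Qed.

(** * Truncations of the given element *)

Section Inversion.
Variables (r : nat) (L : V -> Prop) (w : V -> R) (a : V -> Cx).
Hypothesis HL : is_semigroup_in r L.
Hypothesis Hw : admissible L w.
Variable t : nat -> list V.
Hypothesis t_in : forall n, nodup_in L (t n).
Hypothesis t_tail : forall n, tails_below L w a (t n) (hyp 1 n).

Let L0 : L vzero := proj1 HL.
Let LD : forall x y, L x -> L y -> L (vadd x y) := proj1 (proj2 HL).
Let L_ge0 x (Hx : L x) : forall i, (i < r)%nat -> 0 <= x i := proj1 (proj2 (proj2 HL) x Hx).
Let L_vanish x (Hx : L x) : vanishing_from r x := proj2 (proj2 (proj2 HL) x Hx).
Let w_pos : forall x, L x -> 0 < w x := proj1 (proj1 Hw).
Let w_zero : w vzero = 1 := proj1 (proj2 (proj1 Hw)).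
Let w_sub : forall x y, L x -> L y -> w (vadd x y) <= w x * w y := proj2 (proj2 (proj1 Hw)).
Let w_ge1 : forall x, L x -> 1 <= w x := proj1 (proj2 Hw).

Let an (n : nat) : Poly := restrict a (t n).

Lemma tail_sum_le n k phi c : nodup_in L k -> incl (t n) k -> 0 <= c ->
  (forall x, L x -> Cnorm (phi x) <= c * w x) ->
  Cnorm (Csub (Csum_list (fun x => Cmul (a x) (phi x)) k) (ev phi (an n))) <= c * hyp 1 n.
Proof.
  intros [Hk HkL] Hi Hc Hphi. unfold an. rewrite ev_restrict.
  rewrite (Csum_incl_split _ (t n) k) by (auto; apply t_in).
  match goal with |- Cnorm (Csub (Cadd ?z ?u) ?z) <= _ =>
    replace (Csub (Cadd z u) z) with u by ring end.
  set (k' := filter _ k).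
  apply Rle_trans with (Rsum_list (fun x => c * (Cnorm (a x) * w x)) k').
  - apply Cnorm_sum. intros x Hx. apply filter_In in Hx. rewrite Cnorm_mul.
    specialize (Hphi x (HkL x (proj1 Hx))). pose proof (Cnorm_ge0 (a x)). nra.
  - rewrite Rsum_scal. apply Rmult_le_compat_l; auto. apply t_tail.
    + split; [apply NoDup_filter; auto|]. intros x Hx. apply filter_In in Hx. apply HkL, Hx.
    + intros x Hx. apply filter_In in Hx. apply (proj1 (asbP _)), Hx.
Qed.

Lemma an_cauchy n m : nle L w (psub (an n) (an m)) (hyp 1 n + hyp 1 m).
Proof.
  intros phi c Hc Hphi. rewrite ev_padd, ev_popp.
  set (k := nodup eqdec_classic (t n ++ t m)).
  assert (Hk : nodup_in L k).
  { split; [apply NoDup_nodup|]. intros x Hx. apply nodup_In, in_app_iff in Hx.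
    destruct Hx; eapply t_in; eauto. }
  pose proof (tail_sum_le n k phi c Hk) as H1. pose proof (tail_sum_le m k phi c Hk) as H2.
  set (s := Csum_list (fun x => Cmul (a x) (phi x)) k) in *.
  replace (Csub (ev phi (an n)) (ev phi (an m)))
    with (Csub (Csub s (ev phi (an m))) (Csub s (ev phi (an n)))) by ring.
  eapply Rle_trans; [apply Cnorm_sub|].
  assert (H1' : Cnorm (Csub s (ev phi (an n))) <= c * hyp 1 n).
  { apply H1; auto. intros x Hx. apply nodup_In, in_app_iff. auto. }
  assert (H2' : Cnorm (Csub s (ev phi (an m))) <= c * hyp 1 m).
  { apply H2; auto. intros x Hx. apply nodup_In, in_app_iff. auto. }
  lra.
Qed.

Lemma supp_an n : supp L (an n).
Proof.
  apply Forall_forall. intros u Hu. apply in_map_iff in Hu. destruct Hu as (x & <- & Hx).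
  simpl. eapply t_in; eauto.
Qed.

Definition dirichlet_char (s : nat -> Cx) (x : V) : Cx := Cexp (Copp (dotC r x s)).

Lemma dirichlet_char_eq s x : dirichlet_char s x =
  Cmul (RtoC (exp (- rdot r x (fun i => fst (s i))))) (cis (- rdot r x (fun i => snd (s i)))).
Proof. unfold dirichlet_char. rewrite Cexp_cis, dotC_rdot. reflexivity. Qed.

Lemma dirichlet_char_le s x : in_Hr r s -> L x -> Cnorm (dirichlet_char s x) <= 1 * w x.
Proof.
  intros Hs Hx. rewrite dirichlet_char_eq, Cnorm_mul, Cnorm_cis, Cnorm_RtoC.
  rewrite Rabs_pos_eq by (left; apply exp_pos).
  assert (exp (- rdot r x (fun i => fst (s i))) <= 1).
  { rewrite <- exp_0. apply exp_le.
    pose proof (rdot_ge0 r x (fun i => fst (s i)) (L_ge0 x Hx)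
      (fun i Hi => Rlt_le _ _ (Hs i Hi))). lra. }
  pose proof (w_ge1 x Hx). lra.
Qed.

(** The hypothesis on the closure concerns only points where the series has a value; absolute
    convergence supplies one everywhere on [H^r]. The rate does not depend on [s], so lower bounds
    pass to truncations. *)
Lemma gelfand_value_exists s : in_Hr r s -> exists u, gelfand_value r L a s u /\
  forall n, Cnorm (Csub (ev (dirichlet_char s) (an n)) u) <= hyp 2 n.
Proof.
  intros Hs. set (chi := dirichlet_char s).
  assert (Hchi : forall x, L x -> Cnorm (chi x) <= 1 * w x)
    by (intros; apply dirichlet_char_le; auto).
  assert (Hd : forall k n m, (k <= n)%nat -> (k <= m)%nat ->
    Cnorm (Csub (ev chi (an n)) (ev chi (an m))) <= hyp 2 k).
  { intros k n m Hn Hm. pose proof (an_cauchy n m chi 1 ltac:(lra) Hchi) as H.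
    rewrite ev_padd, ev_popp in H.
    pose proof (hyp_mono 1 k n ltac:(lra) Hn). pose proof (hyp_mono 1 k m ltac:(lra) Hm).
    replace (hyp 2 k) with (hyp 1 k + hyp 1 k) by (unfold hyp, Rdiv; ring). lra. }
  destruct (C_complete (fun n => ev chi (an n))) as [u Hu].
  { intros eps He. destruct (hyp_small 2 eps) as [k Hk]; [lra|lra|]. exists k. intros n m Hn Hm.
    specialize (Hk k (le_n k)). pose proof (Hd k n m Hn Hm). lra. }
  assert (Hun : forall n, Cnorm (Csub (ev chi (an n)) u) <= hyp 2 n).
  { intros n. apply (Cnorm_limit_le (fun m => Csub (ev chi (an n)) (ev chi (an m))) _ _ n).
    - intros eps He. destruct (Hu eps He) as [N HN]. exists N. intros m Hm.
      replace (Csub (Csub (ev chi (an n)) (ev chi (an m))) (Csub (ev chi (an n)) u))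
        with (Csub u (ev chi (an m))) by ring.
      rewrite Cnorm_sub_sym. auto.
    - intros m Hm. apply Hd; auto. }
  exists u. split; auto. intros eps He.
  (* One unit pays for the tail beyond [t n], two for the distance of the truncation from the
     limit. *)
  destruct (hyp_small 3 eps) as [n Hn]; [lra|auto|]. specialize (Hn n (le_n n)).
  destruct (t_in n) as [Htn HtL].
  destruct (map_preimage (@proj1_sig V L) (t n)) as [l0 Hl0].
  { intros y Hy. exists (exist _ y (HtL y Hy)). reflexivity. }
  exists l0. split; [apply (NoDup_map_inv (@proj1_sig V L)); rewrite Hl0; auto|].
  intros l Hl Hi.
  change (Csum_list _ l) with
    (Csum_list (fun j : Lelt L => Cmul (a (proj1_sig j)) (chi (proj1_sig j))) l).
  rewrite <- (Csum_map (J := Lelt L) (@proj1_sig V (fun x => L x)) (fun x => Cmul (a x) (chi x)) l).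
  set (k := map _ l).
  pose proof (tail_sum_le n k chi 1) as H.
  set (z := Csum_list (fun x => Cmul (a x) (chi x)) k) in *.
  replace (Csub z u) with (Cadd (Csub z (ev chi (an n))) (Csub (ev chi (an n)) u)) by ring.
  eapply Rle_lt_trans; [apply Cnorm_add|].
  assert (Cnorm (Csub z (ev chi (an n))) <= 1 * hyp 1 n).
  { apply H; [|rewrite <- Hl0; apply incl_map; exact Hi|lra|exact Hchi].
    split; [apply NoDup_map_injective; auto; apply sig_eq|].
    intros x Hx. apply in_map_iff in Hx. destruct Hx as (y & <- & _). apply (proj2_sig y). }
  specialize (Hun n).
  replace (hyp 3 n) with (hyp 1 n + hyp 2 n) in Hn by (unfold hyp, Rdiv; ring). lra.
Qed.

(** One truncation [p] is inverted up to powers, all later ones are perturbations of it, and [n]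
    Neumann terms then sharpen the error to [(/ 2) ^ n]. *)
Lemma approximate_inverses : ~ in_closure_image r L a C0 ->
  exists B n0 (c : nat -> Poly), 0 <= B /\ forall n, (n0 <= n)%nat ->
    supp L (c n) /\ nle L w (c n) B /\
    nle L w (psub (pmul (an n) (c n)) pone) ((/ 2) ^ n).
Proof.
  intros Hcl.
  assert (Hdelta : exists d, 0 < d /\
    forall s u, in_Hr r s -> gelfand_value r L a s u -> 2 * d <= Cnorm u).
  { apply Classical_Prop.NNPP. intros Hno. apply Hcl. intros eps He.
    apply Classical_Prop.NNPP. intros Hno2. apply Hno. exists (eps / 2). split; [lra|].
    intros s u Hs Hu. apply Rnot_lt_le. intros Hlt. apply Hno2. exists s, u.
    split; [|split]; auto. replace (Csub u C0) with u by ring. lra. }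
  destruct Hdelta as (d & Hd & Hgel).
  (* This choice serves twice: truncation lowers the bound [2 * d] to no less than [d], and later
     truncations differ from [p] by at most [d / 4], half the bound [d / 2] in the inverse
     powers. *)
  destruct (hyp_small 2 (d / 4)) as [n0 Hn0]; [lra|lra|].
  specialize (Hn0 n0 (le_n n0)).
  set (p := an n0).
  set (gs := filter (fun x => asb (x <> vzero)) (t n0)).
  assert (HgsL : forall g, In g gs -> L g).
  { intros g Hg. apply filter_In in Hg. apply (t_in n0), Hg. }
  assert (HmonL : forall x, mon gs x -> L x) by (intros x; apply mon_incl; auto).
  assert (Hlower : forall tau, 0 < tau -> wave_lower_bound r d (tw r tau p)).
  { intros tau Htau y.
    (* With all real parts equal to [tau], the exponential at [s] is the wave at [y] times the twist
       factor. *)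
    set (s := fun i : nat => (tau, y i)).
    assert (Hs : in_Hr r s) by (intros i _; exact Htau).
    destruct (gelfand_value_exists s Hs) as (u & Hu & Hun).
    specialize (Hgel s u Hs Hu). specialize (Hun n0). fold p in Hun.
    rewrite Cnorm_sub_sym in Hun. pose proof (Cnorm_sub_ge u (ev (dirichlet_char s) p)).
    rewrite ev_tw. rewrite (ev_ext _ (dirichlet_char s)); [lra|].
    intros v _. rewrite dirichlet_char_eq. unfold s; simpl. rewrite rdot_const_r.
    unfold wave. rewrite Ropp_mult_distr_l. reflexivity. }
  destruct (weighted_inverse_pow r gs p) with (d := d) (L := L) (w := w)
    as (D & HD & HQ); try assumption.
  { intros g Hg. pose proof (HgsL g Hg). apply vsum_gt0; auto.
    apply filter_In in Hg. apply (proj1 (asbP _)), Hg. }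
  { intros x Hx. apply L_ge0; auto. }
  { intros x Hx. apply L_vanish; auto. }
  { apply Forall_forall. intros u Hu. apply in_map_iff in Hu. destruct Hu as (x & <- & Hx).
    simpl. destruct (excluded_middle_informative (x = vzero)) as [->|Hn].
    - apply mon_zero.
    - apply mon_in, filter_In. split; auto. apply asb_true; auto. }
  destruct (exists_pow_half_le (2 * D) (/ 4)) as [N HN]; [lra|lra|].
  destruct (HQ N (/ 4) ltac:(lra)) as (Q & HQL & Herr & HQn).
  destruct (nle_exists L w p (supp_an n0)) as [P HP].
  set (rr := fun n => psub (an n) p).
  set (b := fun n => pmul (geom p (rr n) N) Q).
  (* The bound is uniform in [n] because [p], [N] and [Q] are fixed; only the perturbation
     varies. *)
  set (Bb := geom_bound P (d / 2 / 2) N * (2 / (d / 2) ^ N * D)).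
  assert (Hrr : forall n, (n0 <= n)%nat -> nle L w (rr n) (d / 2 / 2)).
  { intros n Hn. apply (nle_mono _ _ _ (hyp 1 n + hyp 1 n0)); [|apply an_cauchy].
    pose proof (hyp_mono 1 n0 n ltac:(lra) Hn).
    replace (hyp 2 n0) with (hyp 1 n0 + hyp 1 n0) in Hn0 by (unfold hyp, Rdiv; ring). lra. }
  assert (Hb : forall n, (n0 <= n)%nat -> nle L w (b n) Bb).
  { intros n Hn. apply nle_pmul; auto. apply nle_geom; auto. }
  assert (HbL : forall n, supp L (b n)).
  { intros n. apply supp_pmul; auto. apply supp_geom; auto; [apply supp_an|].
    apply supp_padd; [|apply supp_popp]; apply supp_an. }
  assert (Hab : forall n, (n0 <= n)%nat ->
    nle L w (psub (pmul (an n) (b n)) pone) (/ 2)).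
  { intros n Hn. assert (E : peq (an n) (padd p (rr n))) by (unfold rr; ring).
    rewrite E.
    apply (nle_mono _ _ _ (/ 4 + (d / 2 / 2) ^ N * (2 / (d / 2) ^ N * D))).
    - rewrite pow_decay by lra. lra.
    - apply nle_perturb; auto. }
  exists (Bb * 2), n0, (fun n => neumann (an n) (b n) n). split.
  - pose proof (nle_ge0 L w w_pos (b n0) Bb (Hb n0 (le_n n0))). lra.
  - intros n Hn. split; [|split].
    + apply supp_neumann; auto. apply supp_an.
    + apply nle_neumann; auto.
    + apply nle_neumann_err; auto.
Qed.

(** * Convolution with the limit of the approximate inverses *)

Definition vsub (x y : V) : V := fun i => x i - y i.

Lemma vsub_eq x y z : vadd y z = x <-> z = vsub x y.
Proof.
  split; intros E; subst; apply functional_extensionality; intros i; unfold vadd, vsub; ring.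
Qed.

Lemma coef_restrict_pmul l q x : coef x (pmul (restrict a l) q) =
  Csum_list (fun y => Cmul (a y) (coef (vsub x y) q)) l.
Proof.
  unfold coef. rewrite ev_pmul, ev_restrict. apply Csum_ext. intros y _. f_equal.
  apply ev_ext. intros u _. unfold vdelta.
  destruct (eqdec_classic (vadd y (snd u)) x) as [E|E];
    destruct (eqdec_classic (snd u) (vsub x y)) as [E'|E']; auto;
    [apply vsub_eq in E|apply vsub_eq in E']; contradiction.
Qed.

(** The approximate inverses are Cauchy in norm. Their coefficientwise limit keeps the norm bound by
    a Fatou argument, and its convolution with [a] is compared with that of the truncations. *)
Lemma limit_is_inverse (c : nat -> Poly) B n0 : 0 <= B ->
  in_Aw L w a ->
  (forall n, (n0 <= n)%nat -> supp L (c n) /\ nle L w (c n) B /\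
    nle L w (psub (pmul (an n) (c n)) pone) ((/ 2) ^ n)) ->
  invertible_Aw L w a.
Proof.
  (* The constant comes from [c_m - c_n = c_n (a_m c_m - 1) - c_m (a_n c_n - 1) + c_m c_n (a_n -
     a_m)]. *)
  intros HB Ha Hc. set (E := 2 * B + 2 * (B * B)).
  assert (HE : 0 <= E) by (unfold E; nra).
  assert (Hcc : forall k n m, (n0 <= k)%nat -> (k <= n)%nat -> (k <= m)%nat ->
    nle L w (psub (c m) (c n)) (hyp E k)).
  { intros k n m Hk Hn Hm.
    destruct (Hc n ltac:(lia)) as (_ & Hcn & Hen). destruct (Hc m ltac:(lia)) as (_ & Hcm & Hem).
    assert (Eq : peq (psub (c m) (c n))
      (padd (psub (pmul (c n) (psub (pmul (an m) (c m)) pone))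
                  (pmul (c m) (psub (pmul (an n) (c n)) pone)))
            (pmul (pmul (c m) (c n)) (psub (an n) (an m))))) by ring.
    rewrite Eq.
    apply (nle_mono _ _ _ (B * (/ 2) ^ m + B * (/ 2) ^ n + B * B * (hyp 1 n + hyp 1 m))).
    - pose proof (pow_half_le_hyp n). pose proof (pow_half_le_hyp m).
      pose proof (hyp_mono 1 k n ltac:(lra) Hn). pose proof (hyp_mono 1 k m ltac:(lra) Hm).
      replace (hyp E k) with (B * hyp 1 k + B * hyp 1 k + B * B * (hyp 1 k + hyp 1 k))
        by (unfold E, hyp, Rdiv; ring).
      repeat apply Rplus_le_compat; apply Rmult_le_compat_l; try lra; nra.
    - apply nle_padd; [apply nle_psub|]; repeat apply nle_pmul; auto. apply an_cauchy. }
  (* The implication inside the existential lets choice define [b] on all vectors, with an arbitrary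
     value outside [L]. *)
  assert (Hlim : forall x, exists z, L x -> Ccv (fun n => coef x (c n)) z).
  { intros x. destruct (excluded_middle_informative (L x)) as [Hx|Hx];
      [|exists C0; contradiction].
    destruct (C_complete (fun n => coef x (c n))) as [z Hz]; [|eauto].
    intros eps He. destruct (hyp_small E eps HE He) as [k Hk]. exists (n0 + k)%nat.
    intros n m Hn Hm. specialize (Hk (n0 + k)%nat ltac:(lia)).
    pose proof (coef_le L w _ _ x (Hcc (n0 + k)%nat m n ltac:(lia) Hm Hn) w_ge1 Hx) as H.
    unfold coef in *. rewrite ev_padd, ev_popp in H. lra. }
  set (b := fun x => proj1_sig (constructive_indefinite_description _ (Hlim x))).
  assert (Hb : forall x, L x -> Ccv (fun n => coef x (c n)) (b x)).
  { intros x. exact (proj2_sig (constructive_indefinite_description _ (Hlim x))). }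
  assert (HbB : forall x, L x -> Cnorm (b x) <= B).
  { intros x Hx. apply (Cnorm_limit_le (fun n => coef x (c n)) _ _ n0); auto.
    intros n Hn. apply (coef_le L w); auto. apply Hc, Hn. }
  assert (Hbc : forall n x, (n0 <= n)%nat -> L x ->
    Cnorm (Csub (b x) (coef x (c n))) <= hyp E n).
  { intros n x Hn Hx.
    apply (Cnorm_limit_le (fun m => Csub (coef x (c m)) (coef x (c n))) _ _ n).
    - intros eps He. destruct (Hb x Hx eps He) as [k Hk]. exists k. intros m Hm.
      replace (Csub (Csub (coef x (c m)) (coef x (c n))) (Csub (b x) (coef x (c n))))
        with (Csub (coef x (c m)) (b x)) by ring. auto.
    - intros m Hm. pose proof (coef_le L w _ _ x (Hcc n n m Hn (le_n n) Hm) w_ge1 Hx) as H.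
      unfold coef in *. rewrite ev_padd, ev_popp in H. exact H. }
  exists b. split.
  (* On a given finite list, replacing [b] by the coefficients of a late [c n] costs less than [1];
     how late may depend on the list. *)
  - exists (B + 1). intros l Hl.
    rewrite <- (Rsum_map (J := Lelt L) (@proj1_sig V (fun x => L x))
      (fun x => Cnorm (b x) * w x) l).
    set (k := map _ l).
    assert (Hk : NoDup k) by (apply NoDup_map_injective; auto; apply sig_eq).
    assert (HkL : forall x, In x k -> L x).
    { intros x Hx. apply in_map_iff in Hx. destruct Hx as (y & <- & _). apply (proj2_sig y). }
    assert (HW : 0 <= Rsum_list w k) by (apply Rsum_ge0; intros; left; auto).
    destruct (hyp_small (E * Rsum_list w k) 1) as [n1 Hn1]; [nra|lra|].
    set (n := (n0 + n1)%nat). specialize (Hn1 n ltac:(unfold n; lia)).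
    apply Rle_trans with (Rsum_list (fun x => Cnorm (coef x (c n)) * w x) k
      + hyp E n * Rsum_list w k).
    + rewrite <- Rsum_scal. clear -HkL Hbc w_pos n.
      induction k as [|x k IH]; simpl; [lra|].
      specialize (IH (fun y Hy => HkL y (or_intror Hy))).
      pose proof (HkL x (or_introl eq_refl)) as Hx. pose proof (w_pos x Hx).
      pose proof (Hbc n x ltac:(unfold n; lia) Hx).
      pose proof (Cnorm_sub_ge (b x) (coef x (c n))). nra.
    + apply Rplus_le_compat.
      * apply (sum_coef_le L); auto. apply Hc. unfold n; lia.
      * replace (hyp E n * Rsum_list w k) with (hyp (E * Rsum_list w k) n)
          by (unfold hyp, Rdiv; ring). lra.
  - intros x Hx eps He. destruct (in_Aw_bound L w a Ha) as [A HA].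
    assert (HAa : forall k, nodup_in L k -> Rsum_list (fun y => Cnorm (a y)) k <= A).
    { intros k Hk. eapply Rle_trans; [|apply (HA k Hk)]. apply Rsum_le. intros y Hy.
      pose proof (w_ge1 y (proj2 Hk y Hy)). pose proof (Cnorm_ge0 (a y)). nra. }
    assert (HA0 : 0 <= A).
    { apply (HA []). split; [constructor|intros y []]. }
    (* Three errors: [B] for the tail of [a], [E * A] for replacing [b] by the coefficients of
       [c n], and [1] for the defect of [c n] as an inverse. *)
    destruct (hyp_small (B + E * A + 1) eps) as [n1 Hn1]; [nra|auto|].
    set (n := (n0 + n1)%nat). assert (Hnn : (n0 <= n)%nat) by (unfold n; lia).
    specialize (Hn1 n ltac:(unfold n; lia)).
    destruct (Hc n Hnn) as (Hcs & _ & Herr).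
    (* Of the truncation, only those [y] count for which [x - y] lies in [L]; they are its first
       components of pairs with sum [x]. *)
    set (k := filter (fun y => asb (L (vsub x y))) (t n)).
    assert (Hk : nodup_in L k).
    { split; [apply NoDup_filter, t_in|]. intros y Hy. apply filter_In in Hy.
      apply (t_in n), Hy. }
    assert (HkL : forall y, In y k -> L (vsub x y)).
    { intros y Hy. apply filter_In in Hy. apply (proj1 (asbP _)), Hy. }
    set (f := fun q : Lpairs L x => fst (proj1_sig q)).
    destruct (map_preimage f k) as [l0 Hl0].
    { intros y Hy.
      assert (Hp : L y /\ L (vsub x y) /\ vadd y (vsub x y) = x).
      { split; [apply Hk, Hy|]. split; [apply HkL, Hy|]. apply vsub_eq. reflexivity. }
      exists (exist (fun q => L (fst q) /\ L (snd q) /\ vadd (fst q) (snd q) = x)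
        (y, vsub x y) Hp). reflexivity. }
    exists l0. split; [apply (NoDup_map_inv f); rewrite Hl0; apply Hk|].
    intros l Hl Hi.
    (* A pair is determined by its first component, so the sum over pairs becomes a sum over vectors
       [y]. *)
    assert (Hsnd : forall q : Lpairs L x, snd (proj1_sig q) = vsub x (f q)).
    { intros [[y z] (Hy & Hz & Hyz)]. apply vsub_eq. exact Hyz. }
    rewrite (Csum_ext _ (fun q => Cmul (a (f q)) (b (vsub x (f q))))).
    2: { intros q _. rewrite <- Hsnd. reflexivity. }
    rewrite <- (Csum_map f (fun y => Cmul (a y) (b (vsub x y))) l).
    set (u := map f l).
    assert (Hu : NoDup u).
    { apply NoDup_map_injective; auto. intros q q' Eq. apply sig_eq.
      rewrite (surjective_pairing (proj1_sig q)), (surjective_pairing (proj1_sig q')).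
      rewrite !Hsnd. unfold f in *. rewrite Eq. reflexivity. }
    assert (HuL : forall y, In y u -> L y /\ L (vsub x y)).
    { intros y Hy. apply in_map_iff in Hy. destruct Hy as (q & <- & _).
      rewrite <- Hsnd. destruct (proj2_sig q) as (H1 & H2 & _). split; auto. }
    assert (Hku : incl k u) by (rewrite <- Hl0; apply incl_map; auto).
    rewrite (Csum_incl_split _ k u) by (auto; apply Hk).
    set (u' := filter _ u).
    assert (H1 : Cnorm (Csum_list (fun y => Cmul (a y) (b (vsub x y))) u') <= B * hyp 1 n).
    { apply Rle_trans with (Rsum_list (fun y => B * (Cnorm (a y) * w y)) u').
      - apply Cnorm_sum. intros y Hy. apply filter_In in Hy.
        destruct (HuL y (proj1 Hy)) as [Hy1 Hy2]. rewrite Cnorm_mul.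
        specialize (HbB _ Hy2). pose proof (w_ge1 y Hy1). pose proof (Cnorm_ge0 (a y)).
        pose proof (Cnorm_ge0 (b (vsub x y))). rewrite <- Rmult_assoc, (Rmult_comm B).
        apply Rle_trans with (Cnorm (a y) * B); [apply Rmult_le_compat_l; auto|].
        assert (0 <= Cnorm (a y) * B) by nra. nra.
      - rewrite Rsum_scal. apply Rmult_le_compat_l; auto. apply t_tail.
        + split; [apply NoDup_filter; auto|]. intros y Hy. apply filter_In in Hy.
          apply HuL, Hy.
        + intros y Hy Hyt. apply filter_In in Hy. destruct Hy as [Hy1 Hy2].
          apply (proj1 (asbP _)) in Hy2. apply Hy2, filter_In. split; auto.
          apply asb_true. apply HuL, Hy1. }
    assert (H2 : Cnorm (Csub (Csum_list (fun y => Cmul (a y) (b (vsub x y))) k)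
      (coef x (pmul (an n) (c n)))) <= hyp E n * A).
    { unfold an at 1. rewrite coef_restrict_pmul.
      rewrite <- (Csum_filter (fun y => Cmul (a y) (coef (vsub x y) (c n)))
        (fun y => asb (L (vsub x y)))).
      2: { intros y _ Hy. rewrite (coef_out_of_supp L); auto; [ring|].
           intros HLy. rewrite asb_true in Hy by auto. discriminate. }
      fold k.
      replace (Csub (Csum_list (fun y => Cmul (a y) (b (vsub x y))) k)
          (Csum_list (fun y => Cmul (a y) (coef (vsub x y) (c n))) k))
        with (Csum_list (fun y => Cmul (a y) (Csub (b (vsub x y)) (coef (vsub x y) (c n)))) k).
      2: { rewrite (Csum_ext _ (fun y => Cadd (Cmul (a y) (b (vsub x y)))
             (Cmul (Copp C1) (Cmul (a y) (coef (vsub x y) (c n)))))) by (intros; ring).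
           rewrite Csum_add, Csum_scal. ring. }
      apply Rle_trans with (Rsum_list (fun y => hyp E n * Cnorm (a y)) k).
      - apply Cnorm_sum. intros y Hy. rewrite Cnorm_mul, Rmult_comm.
        apply Rmult_le_compat_r; [apply Cnorm_ge0|]. apply Hbc; auto.
      - rewrite Rsum_scal. apply Rmult_le_compat_l; [apply hyp_ge0; auto|]. apply HAa, Hk. }
    assert (H3 : Cnorm (Csub (coef x (pmul (an n) (c n))) (vdelta x vzero)) <= hyp 1 n).
    { pose proof (coef_le L w _ _ x Herr w_ge1 Hx) as H.
      unfold coef in *. rewrite ev_padd, ev_popp, ev_pone in H.
      pose proof (pow_half_le_hyp n). lra. }
    assert (Hdelta : (if excluded_middle_informative (x = vzero) then C1 else C0)
      = vdelta x vzero).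
    { destruct (excluded_middle_informative (x = vzero)) as [->|Hn].
      - rewrite vdelta_eq. reflexivity.
      - rewrite vdelta_neq; auto. }
    rewrite Hdelta.
    set (z1 := Csum_list _ k) in *. set (z2 := Csum_list _ u') in *.
    set (z3 := coef x (pmul (an n) (c n))) in *.
    replace (Csub (Cadd z1 z2) (vdelta x vzero))
      with (Cadd z2 (Cadd (Csub z1 z3) (Csub z3 (vdelta x vzero)))) by ring.
    eapply Rle_lt_trans; [apply Cnorm_add|].
    pose proof (Cnorm_add (Csub z1 z3) (Csub z3 (vdelta x vzero))).
    replace (hyp (B + E * A + 1) n) with (B * hyp 1 n + hyp E n * A + hyp 1 n) in Hn1
      by (unfold hyp, Rdiv; ring). lra.
Qed.
End Inversion.

Theorem theorem4 (r : nat) (L : (nat -> R) -> Prop) (w : (nat -> R) -> R)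
    (a : (nat -> R) -> Cx) :
  is_semigroup_in r L ->
  admissible L w ->
  in_Aw L w a ->
  ~ in_closure_image r L a C0 ->
  invertible_Aw L w a.
Proof.
  intros HL Hw Ha Hcl.
  destruct (truncations L w a Ha) as [t Ht].
  assert (t_in : forall n, nodup_in L (t n)) by (intros n; apply Ht).
  assert (t_tail : forall n, tails_below L w a (t n) (hyp 1 n)) by (intros n; apply Ht).
  destruct (approximate_inverses r L w a HL Hw t t_in t_tail Hcl) as (B & n0 & c & HB & Hc).
  exact (limit_is_inverse r L w a HL Hw t t_in t_tail c B n0 HB Ha Hc).
Qed.
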